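(* For every $n\ge 2$ there is a constant $w(n)>0$ such that any spherical $n$-space form has a normal covering space $\hat M$ of order $\le w(n)$ which contains two compact totally geodesic submanifolds $M_1,M_2\subset \hat M$ with $|M_1M_2|:=\min\{|x_1x_2| : x_1\in M_1, x_2\in M_2\}\ge\frac{\pi}{2}$ and $\dim(M_1)+\dim(M_2)=n-1$.
   Context: A spherical $n$-space form is a quotient $\mathbb{S}^n/\Gamma$ of the unit sphere $\mathbb{S}^n$ by a finite group $\Gamma$ acting freely by isometries, with the induced Riemannian metric; covering spaces carry the pulled-back metric, and the order of a covering is its number of sheets. Submanifolds are connected and without boundary (a $0$-dimensional one is a single point). $|xy|$ denotes distance. *)

(* Defs.v *)
From HB Require Import structures.
From mathcomp Require Import all_boot all_order all_algebra fingroup action.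
From mathcomp Require Import all_classical all_reals all_analysis.
Set Implicit Arguments.
Unset Strict Implicit.
Unset Printing Implicit Defensive.
Import Order.TTheory GRing.Theory Num.Theory.
Import numFieldNormedType.Exports.
Local Open Scope classical_set_scope.
Local Open Scope ring_scope.
Local Open Scope quotient_scope.

Definition dot (R : realType) (m : nat) (x y : 'rV[R]_m) : R :=
  \sum_(i < m) x 0 i * y 0 i.

(* Used through the coercion of sets to types, hence with the topology induced
   by the inclusion in R^(n+1). *)
Definition sphere (R : realType) (n : nat) : set 'rV[R]_n.+1 :=
  [set x | dot x x = 1].
Arguments sphere : clear implicits.

(* The Riemannian (angular) distance of the unit sphere, not the chordal one. *)
Definition sphere_dist (R : realType) (n : nat) (x y : sphere R n) : R :=
  acos (dot (\val x) (\val y)).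

(* The library states these three facts for actions on finite types only. *)
Lemma total_actM (T : Type) (gT : finGroupType) (to : {action gT &-> T})
    (x : T) (a b : gT) : to x (a * b)%g = to (to x a) b.
Proof. by case: to => to [_ toM] /=; apply: toM; rewrite finset.inE. Qed.

Lemma total_act1 (T : Type) (gT : finGroupType) (to : {action gT &-> T})
    (x : T) : to x 1%g = x.
Proof.
have inj : left_injective to by case: to => to [].
apply: (inj 1%g).
by rewrite -total_actM mulg1.
Qed.

Lemma total_actK (T : Type) (gT : finGroupType) (to : {action gT &-> T})
    (x : T) (a : gT) : to (to x a) a^-1%g = x.
Proof. by rewrite -total_actM mulgV total_act1. Qed.

Definition isometric_action (R : realType) (n : nat) (gT : finGroupType)
    (to : {action gT &-> sphere R n}) : Prop :=
  forall (a : gT) (x y : sphere R n),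
    sphere_dist (to x a) (to y a) = sphere_dist x y.

Definition free_action (T : Type) (gT : finGroupType)
    (to : {action gT &-> T}) : Prop :=
  forall (a : gT) (x : T), to x a = x -> a = 1%g.

Section SpaceForm.
Variables (R : realType) (n : nat) (gT : finGroupType).
Variable to : {action gT &-> sphere R n}.

Definition same_orbit (x y : sphere R n) : bool := [exists a, to x a == y].

Lemma same_orbit_refl : reflexive same_orbit.
Proof. by move=> x; apply/existsP; exists 1%g; rewrite total_act1. Qed.

Lemma same_orbit_sym : symmetric same_orbit.
Proof.
suff H x y : same_orbit x y -> same_orbit y x.
  by move=> x y; apply/idP/idP; exact: H.
by case/existsP=> a /eqP <-; apply/existsP; exists a^-1%g; rewrite total_actK.
Qed.

Lemma same_orbit_trans : transitive same_orbit.
Proof.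
move=> y x z /existsP[a /eqP <-] /existsP[b /eqP <-].
by apply/existsP; exists (a * b)%g; rewrite total_actM.
Qed.

Canonical same_orbit_equiv :=
  EquivRel same_orbit same_orbit_refl same_orbit_sym same_orbit_trans.

Definition space_form : topologicalType :=
  quotient_topology {eq_quot same_orbit}.

Definition space_form_proj (x : sphere R n) : space_form :=
  \pi_(quotient_topology {eq_quot same_orbit}) x.

(* For a free isometric action of a finite group this is the distance of the
   Riemannian metric that makes space_form_proj a local isometry. *)
Definition space_form_dist (X Y : space_form) : R :=
  inf [set r : R | exists x y : sphere R n,
    [/\ space_form_proj x = X, space_form_proj y = Y & r = sphere_dist x y]].

End SpaceForm.

Section Covering.
Variables (E B : topologicalType) (p : E -> B).

Definition evenly_covered (U : set B) : Prop :=
  exists (I : Type) (V : I -> set E),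
    [/\ forall i, open (V i),
        trivIset [set: I] V,
        p @^-1` U = \bigcup_i V i
      & forall i, exists s : B -> E,
          [/\ {within U, continuous s},
              forall u, U u -> V i (s u) /\ p (s u) = u
            & forall x, V i x -> s (p x) = x]].

Definition covering : Prop :=
  [/\ continuous p, range p = [set: B]
    & forall b : B, exists U : set B, [/\ open U, U b & evenly_covered U]].

Definition deck_transformation (f : E -> E) : Prop :=
  [/\ continuous f, p \o f = p
    & exists g : E -> E, [/\ continuous g, cancel f g & cancel g f]].

Definition normal_covering : Prop :=
  [/\ covering, connected [set: E]
    & forall x y : E, p x = p y ->
        exists f : E -> E, deck_transformation f /\ f x = y].

Definition covering_order (k : nat) : Prop :=
  forall b : B, (p @^-1` [set b] #= `I_k)%card.

End Covering.

Section PulledBackMetric.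
Variables (R : realType) (E B : topologicalType).
Variables (dB : B -> B -> R) (p : E -> B).
Local Open Scope ereal_scope.

Definition curve_length (c : R -> B) : \bar R :=
  ereal_sup [set (let F := c \o nth 1%R (0%R :: s) in
                  \sum_(0 <= i < size s) dB (F i) (F i.+1))%R%:E
            | s in itv_partition (0 : R)%R 1%R].

(* The distance between x and y along curves contained in N. As lengths in E
   for the pulled-back metric are the lengths of the projections to B, this is
   the distance of the Riemannian metric induced on N; it is +oo if x and y are
   not joined by a rectifiable curve in N, in particular if x or y is not
   in N. *)
Definition length_dist (N : set E) (x y : E) : \bar R :=
  ereal_inf [set l : \bar R | exists c : R -> E,
    [/\ {within `[0%R, 1%R], continuous c},
        forall t : R, `[0%R, 1%R]%classic t -> N (c t),
        c 0%R = x, c 1%R = y & l = curve_length (p \o c)]].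

Definition covering_dist : E -> E -> \bar R := length_dist [set: E].

Definition set_dist (M1 M2 : set E) : \bar R :=
  ereal_inf [set covering_dist z.1 z.2 | z in M1 `*` M2].

End PulledBackMetric.

(* Geodesics are the locally minimizing curves of constant speed v. *)
Definition geodesic (R : realType) (E : Type) (d : E -> E -> \bar R)
    (a b : R) (c : R -> E) : Prop :=
  exists v : R, 0 <= v /\
    forall t : R, a < t < b -> exists e : R, 0 < e /\
      forall s s' : R, a < s < b -> a < s' < b ->
        `|s - t| < e -> `|s' - t| < e ->
        d (c s) (c s') = (v * `|s - s'|)%:E.

Definition totally_geodesic (R : realType) (E B : topologicalType)
    (dB : B -> B -> R) (p : E -> B) (N : set E) : Prop :=
  forall (a b : R) (c : R -> E),
    geodesic (length_dist dB p N) a b c -> geodesic (covering_dist dB p) a b c.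

(* On an open set U: f is of class C^k. *)
Fixpoint class_C (R : realType) (V W : normedModType R) (k : nat) (U : set V)
    (f : V -> W) : Prop :=
  match k with
  | 0%N => forall x, U x -> {for x, continuous f}
  | k'.+1 => (forall x, U x -> differentiable f x) /\
             forall v : V, class_C k' U (fun x => 'D_v f x)
  end.

Definition smooth_on (R : realType) (V W : normedModType R) (U : set V)
    (f : V -> W) : Prop := forall k : nat, class_C k U f.

(* A is a k-dimensional smooth (embedded) submanifold of R^(n+1), presented
   locally as the zero set of a submersion to R^(c+1); n + 1 = k + (c + 1). *)
Definition euclidean_submanifold (R : realType) (n k : nat)
    (A : set 'rV[R]_n.+1) : Prop :=
  forall x, A x ->
    exists (c : nat) (U : set 'rV[R]_n.+1) (F : 'rV[R]_n.+1 -> 'rV[R]_c.+1),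
      [/\ (k + c = n)%N, open U /\ U x, smooth_on U F,
          forall y, U y -> range ('d F y) = setT
        & A `&` U = [set y | U y /\ F y = 0]].

Section Submanifold.
Variables (R : realType) (n : nat) (gT : finGroupType).
Variable to : {action gT &-> sphere R n}.
Variables (E : topologicalType) (p : E -> space_form to).

(* The smooth structure of the covering space is given by the local lifts
   q : W -> E of the projection of the sphere, which are local isometries. *)
Definition local_lift (W : set (sphere R n)) (q : sphere R n -> E) : Prop :=
  [/\ open W, {within W, continuous q}
    & forall w, W w -> p (q w) = space_form_proj to w].

Definition smooth_submanifold (k : nat) (N : set E) : Prop :=
  forall x, N x ->
    exists (W : set (sphere R n)) (q : sphere R n -> E),
      [/\ local_lift W q, exists w, W w /\ q w = x
        & euclidean_submanifold k
            [set \val w | w in [set w : sphere R n | W w /\ N (q w)]]].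

Definition compact_totally_geodesic_submanifold (k : nat) (N : set E) : Prop :=
  [/\ smooth_submanifold k N, N !=set0, connected N, compact N
    & totally_geodesic (@space_form_dist R n gT to) p N].

End Submanifold.

(* Main.v *)
Require Import Defs.
From HB Require Import structures.
From mathcomp Require Import all_boot all_order all_algebra fingroup action cyclic.
From mathcomp Require Import all_classical all_reals all_analysis.
From mathcomp Require Import ring lra zify.
Set Implicit Arguments.
Unset Strict Implicit.
Unset Printing Implicit Defensive.
Import Order.TTheory GRing.Theory Num.Theory.
Import numFieldNormedType.Exports.
Local Open Scope classical_set_scope.
Local Open Scope ring_scope.
Local Open Scope quotient_scope.

(** The isometries of the sphere are the restrictions of orthogonal matrices, so
    the theorem is about a finite group G of orthogonal matrices none of which,
    but the identity, has a fixed vector.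

    The covering. As in the theorem of Jordan on finite linear groups, let A be
    the subgroup generated by the elements of G close to the identity
    ([near1_group]). It is normal since the Frobenius distance to the identity is
    invariant under conjugation, and its index is bounded in terms of n since
    the orthogonal matrices form a bounded set, which contains a bounded number
    of elements far from each other ([near1_group_index]). Any two of its
    generators commute ([near1_commute]): forming commutators brings elements
    closer to the identity, so that it suffices to exclude a commutator
    z = [[a, b]] that differs from 1 and commutes with a; all powers of such a z
    would be close to the identity, whereas they have average 0, because z has no
    fixed vector. An abelian group of matrices without fixed vectors is cyclic.
    Therefore the quotient of the sphere by A is a normal covering of bounded
    order, and A has a generator g.

    The submanifolds. A unit vector x at which the quadratic form of g is maximal
    is an eigenvector of g + g^T, and then x and x g span a subspace P of
    dimension 1 or 2 that is invariant under g ([orthogonal_invariant_plane]).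
    Its orthogonal complement is invariant as well, and both are nonzero as
    n >= 2. The unit spheres of the two subspaces, of dimensions that add up to
    n - 1, have distance pi / 2 everywhere; their images in the quotient by A are
    the required submanifolds, except that a sphere of dimension 0, which consists
    of two points, is replaced by one of them ([exists_totally_geodesic]).

    The metric. Everything about the length metric of the covering follows from
    two facts: a curve of the covering from the image of x to Y is at least as
    long as the distance from x to some lift of Y ([exists_lift_end]), and the
    image of an arc of the sphere is at most as long as the arc
    ([curve_length_le]). The first fact bounds the distance of the two
    submanifolds from below, because all the lifts of their points have distance
    pi / 2. Together they show that on each submanifold the intrinsic distance is
    the distance of the covering, which makes it totally geodesic
    ([length_dist_covering_dist]). *)

(** * Euclidean geometry of row vectors *)

Section Dot.
Variables (R : realType) (m : nat).
Implicit Types x y z : 'rV[R]_m.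

Lemma dotE x y : dot x y = (x *m y^T) 0 0.
Proof. by rewrite !mxE; apply: eq_bigr => i _; rewrite mxE. Qed.

Lemma dotC x y : dot x y = dot y x.
Proof. by apply: eq_bigr => i _; rewrite mulrC. Qed.

Lemma dotDl x y z : dot (x + y) z = dot x z + dot y z.
Proof. by rewrite !dotE mulmxDl mxE. Qed.

Lemma dotDr x y z : dot x (y + z) = dot x y + dot x z.
Proof. by rewrite dotC dotDl !(dotC x). Qed.

Lemma dotZl k x y : dot (k *: x) y = k * dot x y.
Proof. by rewrite !dotE -scalemxAl mxE. Qed.

Lemma dotZr k x y : dot x (k *: y) = k * dot x y.
Proof. by rewrite dotC dotZl (dotC x). Qed.

Lemma dotNl x y : dot (- x) y = - dot x y.
Proof. by rewrite -scaleN1r dotZl mulN1r. Qed.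

Lemma dotNr x y : dot x (- y) = - dot x y.
Proof. by rewrite dotC dotNl (dotC x). Qed.

Definition dot_lin := (dotDl, dotDr, dotZl, dotZr, dotNl, dotNr).

Lemma dot0l x : dot 0 x = 0.
Proof. by rewrite dotE mul0mx mxE. Qed.

Lemma dot_ge0 x : 0 <= dot x x.
Proof. by apply: sumr_ge0 => i _; rewrite -expr2 sqr_ge0. Qed.

Lemma dot_eq0 x : dot x x = 0 -> x = 0.
Proof.
move=> /eqP; rewrite psumr_eq0 => [/allP x0|i _]; last by rewrite -expr2 sqr_ge0.
apply/rowP => i; rewrite mxE; apply/eqP.
by have /implyP := x0 i (mem_index_enum i); rewrite mulf_eq0 orbb; exact.
Qed.

Lemma dot_gt0 x : x != 0 -> 0 < dot x x.
Proof.
move=> x0; rewrite lt_neqAle dot_ge0 andbT eq_sym.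
by apply: contra_neq x0; exact: dot_eq0.
Qed.

Lemma cauchy_schwarz x y : dot x y ^+ 2 <= dot x x * dot y y.
Proof.
have [->|/dot_gt0 y0] := eqVneq y 0.
  by rewrite !(dotC _ 0) !dot0l mulr0 expr0n.
have := dot_ge0 (dot y y *: x - dot x y *: y).
rewrite !dot_lin (dotC y x).
set a := dot x x; set b := dot y y in y0 *; set c := dot x y => H.
have {}H : 0 <= b * (a * b - c ^+ 2) by move: H; congr (0 <= _); ring.
by move: H; rewrite pmulr_rge0// subr_ge0.
Qed.

Lemma dot_mulmx x y (M : 'M[R]_m) : dot (x *m M) y = dot x (y *m M^T).
Proof. by rewrite !dotE trmx_mul trmxK mulmxA. Qed.

Lemma dot_delta x i : dot x (delta_mx 0 i) = x 0 i.
Proof.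
rewrite /dot (bigD1 i)//= big1 ?addr0 => [|j /negPf ji].
  by rewrite mxE !eqxx mulr1.
by rewrite mxE ji andbF mulr0.
Qed.

Lemma dot_delta_delta i : dot (delta_mx 0 i) (delta_mx 0 i : 'rV[R]_m) = 1.
Proof. by rewrite dot_delta mxE !eqxx. Qed.

End Dot.

Section SphereDist.
Variables (R : realType) (n : nat).
Implicit Types x y z : 'rV[R]_n.+1.

Lemma sphere_dot (x : sphere R n) : dot (\val x) (\val x) = 1.
Proof. exact: (set_valP x). Qed.

Definition mks x (x1 : sphere R n x) : sphere R n := exist _ x (mem_set x1).

Lemma sphere_normalize (x : 'rV[R]_n.+1) : x != 0 ->
  exists k, k != 0 /\ sphere R n (k *: x).
Proof.
move=> x0; exists (Num.sqrt (dot x x))^-1.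
have d0 : 0 < Num.sqrt (dot x x) by rewrite sqrtr_gt0 dot_gt0.
split; first by rewrite invr_eq0 gt_eqF.
rewrite /sphere /= !dot_lin -[X in _ * (_ * X)]sqr_sqrtr ?dot_ge0//.
by field; rewrite gt_eqF.
Qed.

Lemma unit_dot_bound x y : dot x x = 1 -> dot y y = 1 -> -1 <= dot x y <= 1.
Proof.
move=> x1 y1; have := cauchy_schwarz x y; rewrite x1 y1 mulr1 => H.
by apply/andP; split; nra.
Qed.

Lemma sphere_dot_bound (x y : sphere R n) : -1 <= dot (\val x) (\val y) <= 1.
Proof. by apply: unit_dot_bound; exact: sphere_dot. Qed.

Lemma cos_sphere_dist (x y : sphere R n) :
  cos (sphere_dist x y) = dot (\val x) (\val y).
Proof. by rewrite acosK// in_itv/= sphere_dot_bound. Qed.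

Lemma sphere_dist_ge0 (x y : sphere R n) : 0 <= sphere_dist x y.
Proof. by rewrite acos_ge0// sphere_dot_bound. Qed.

Lemma sphere_dist_lepi (x y : sphere R n) : sphere_dist x y <= pi.
Proof. by rewrite acos_lepi// sphere_dot_bound. Qed.

Lemma sphere_dist_itv (x y : sphere R n) : sphere_dist x y \in `[0, pi].
Proof. by rewrite in_itv/= sphere_dist_ge0 sphere_dist_lepi. Qed.

Lemma ler_cos_itv (a b : R) : a \in `[0, pi] -> b \in `[0, pi] ->
  (cos a <= cos b) = (b <= a).
Proof. by move=> ha hb; rewrite !leNgt ltr_cos. Qed.

Lemma sphere_dist_le (x y x' y' : sphere R n) :
  (sphere_dist x y <= sphere_dist x' y') =
  (dot (\val x') (\val y') <= dot (\val x) (\val y)).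
Proof.
rewrite -!cos_sphere_dist.
by rewrite ler_cos_itv ?sphere_dist_itv.
Qed.

Lemma sphere_dist0 (x y : sphere R n) : \val x = \val y -> sphere_dist x y = 0.
Proof. by move=> e; rewrite /sphere_dist e sphere_dot acos1. Qed.

(** By Cauchy-Schwarz for the components of [x] and [z] orthogonal to [y], the
    cosine of the sum of the two angles at [y] is at most [dot x z]. *)
Lemma sphere_dist_triangle (y x z : sphere R n) :
  sphere_dist x z <= sphere_dist x y + sphere_dist y z.
Proof.
set a := sphere_dist x y; set b := sphere_dist y z.
have [ab|ab] := leP pi (a + b).
  by apply: le_trans ab; exact: sphere_dist_lepi.
have a0 : 0 <= a := sphere_dist_ge0 x y.
have b0 : 0 <= b := sphere_dist_ge0 y z.
rewrite -(@cosK _ (a + b)); last by rewrite in_itv/=; apply/andP; split; lra.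
have cab : -1 <= cos (a + b) <= 1 by rewrite cos_geN1 cos_le1.
rewrite leNgt; apply/negP => lt_ab.
have : cos (sphere_dist x z) < cos (acos (cos (a + b))).
  rewrite ltNge; apply/negP => le_cos; move: lt_ab; rewrite ltNge => /negP; apply.
  by rewrite -ler_cos_itv ?sphere_dist_itv ?in_itv/= ?acos_ge0 ?acos_lepi.
rewrite acosK ?in_itv//= cosD !cos_sphere_dist.
have sa : 0 <= sin a by rewrite sin_ge0_pi// sphere_dist_ge0 sphere_dist_lepi.
have sb : 0 <= sin b by rewrite sin_ge0_pi// sphere_dist_ge0 sphere_dist_lepi.
have sa2 := sin2cos2 a; have sb2 := sin2cos2 b.
rewrite !cos_sphere_dist in sa2 sb2.
have := cauchy_schwarz (\val x - dot (\val x) (\val y) *: \val y)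
                       (\val z - dot (\val y) (\val z) *: \val y).
rewrite !dot_lin !sphere_dot (dotC (\val y) (\val x)) (dotC (\val z) (\val y)).
set p := dot (\val x) (\val y) in sa2 *; set q := dot (\val y) (\val z) in sb2 *.
set r := dot (\val x) (\val z) => H.
have {}H : (r - p * q) ^+ 2 <= (sin a * sin b) ^+ 2.
  by rewrite exprMn sa2 sb2; move: H; congr (_ <= _); ring.
have sab : 0 <= sin a * sin b by rewrite mulr_ge0.
suff : `|r - p * q| <= sin a * sin b by rewrite ler_norml => /andP[]; lra.
by rewrite -(ger0_norm sab) -ler_sqr ?nnegrE// !real_normK// num_real.
Qed.

End SphereDist.

(** * Finite groups of isometries of the sphere *)

Section Frobenius.
Variables (R : realType) (m : nat).
Implicit Types M N : 'M[R]_m.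

Definition fro M := \sum_i \sum_j M i j ^+ 2.

Lemma froE M : fro M = \tr (M *m M^T).
Proof.
apply: eq_bigr => i _; rewrite mxE; apply: eq_bigr => j _.
by rewrite mxE expr2.
Qed.

Lemma fro_ge0 M : 0 <= fro M.
Proof. by apply: sumr_ge0 => i _; apply: sumr_ge0 => j _; exact: sqr_ge0. Qed.

Lemma froN M : fro (- M) = fro M.
Proof.
by apply: eq_bigr => i _; apply: eq_bigr => j _; rewrite mxE sqrrN.
Qed.

Lemma fro_eq0 M : fro M = 0 -> M = 0.
Proof.
move=> M0; apply/matrixP => i j; rewrite mxE; apply/eqP; rewrite -sqrf_eq0.
have P a b : 0 <= M a b ^+ 2 := sqr_ge0 _.
have : M i j ^+ 2 <= 0.
  rewrite -M0 /fro (bigD1 i)//= (bigD1 j)//= -addrA lerDl addr_ge0//.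
    exact: sumr_ge0.
  by apply: sumr_ge0 => k _; exact: sumr_ge0.
by move=> le0; rewrite eq_le le0 P.
Qed.

Lemma froD_le M N : fro (M + N) <= 2 * fro M + 2 * fro N.
Proof.
rewrite /fro !mulr_sumr -big_split; apply: ler_sum => i _ /=.
rewrite !mulr_sumr -big_split; apply: ler_sum => j _ /=; rewrite mxE.
by have := sqr_ge0 (M i j - N i j); nra.
Qed.

Lemma froM_le M N : fro (M *m N) <= fro M * fro N.
Proof.
have -> : fro M * fro N = \sum_i \sum_j (\sum_k M i k ^+ 2) * (\sum_k N k j ^+ 2).
  rewrite /fro mulr_suml; apply: eq_bigr => i _.
  by rewrite -mulr_sumr (exchange_big _ _ _ _ _ (fun k j => N k j ^+ 2)).
apply: ler_sum => i _; apply: ler_sum => j _; rewrite mxE.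
have := cauchy_schwarz (\row_k M i k) (\row_k N k j); rewrite /dot.
under eq_bigr do rewrite !mxE; under [X in _ <= X * _]eq_bigr do rewrite !mxE.
by under [X in _ <= _ * X]eq_bigr do rewrite !mxE.
Qed.

Lemma fro_mulmxr M (Q : 'M[R]_m) : Q *m Q^T = 1%:M -> fro (M *m Q) = fro M.
Proof.
by move=> QQ; rewrite !froE trmx_mul mulmxA -(mulmxA M) QQ mulmx1.
Qed.

Lemma fro_mulmxl M (Q : 'M[R]_m) : Q *m Q^T = 1%:M -> fro (Q *m M) = fro M.
Proof.
move=> /mulmx1C QQ; rewrite !froE trmx_mul mxtrace_mulC !mulmxA.
by rewrite -(mulmxA _ Q^T) QQ mulmx1 mxtrace_mulC.
Qed.

Lemma fro_orthogonal_sub1 (Q : 'M[R]_m) :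
  Q *m Q^T = 1%:M -> fro (Q - 1%:M) = 2 * \tr (1%:M - Q).
Proof.
move=> QQ; rewrite froE linearB/= trmx1 mulmxBl !mulmxBr QQ !mulmx1 !mul1mx.
by rewrite !linearB/= mxtrace_tr; ring.
Qed.

End Frobenius.

Section Representation.
Variables (R : realType) (n : nat) (gT : finGroupType).
Variable to : {action gT &-> sphere R n}.
Hypothesis iso : isometric_action to.

Definition basis_point (i : 'I_n.+1) : sphere R n :=
  mks (dot_delta_delta R i).

Definition rho (a : gT) : 'M[R]_n.+1 :=
  \matrix_(i, j) (\val (to (basis_point i) a)) 0 j.

Lemma to_dot (a : gT) (x y : sphere R n) :
  dot (\val (to x a)) (\val (to y a)) = dot (\val x) (\val y).
Proof. by rewrite -!cos_sphere_dist iso. Qed.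

Lemma row_rho a i : row i (rho a) = \val (to (basis_point i) a).
Proof. by apply/rowP => j; rewrite !mxE. Qed.

Lemma rho_orthogonal a : rho a *m (rho a)^T = 1%:M.
Proof.
apply/matrixP => i j; transitivity (dot (row i (rho a)) (row j (rho a))).
  by rewrite mxE; apply: eq_bigr => k _; rewrite !mxE.
by rewrite !row_rho to_dot /= dot_delta !mxE eqxx /= eq_sym.
Qed.

(** The coordinates of the image of [x] in the orthonormal family formed by the
    images of the canonical basis are those of [x]. *)
Lemma to_rho x a : \val (to x a) = \val x *m rho a.
Proof.
suff : \val (to x a) *m (rho a)^T = \val x.
  move=> /(congr1 (mulmx^~ (rho a))).
  by rewrite -mulmxA (mulmx1C (rho_orthogonal a)) mulmx1.
apply/rowP => i; transitivity (dot (\val (to x a)) (row i (rho a))).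
  by rewrite mxE; apply: eq_bigr => k _; rewrite !mxE.
by rewrite row_rho to_dot dot_delta.
Qed.

Lemma rhoM a b : rho (a * b)%g = rho a *m rho b.
Proof.
by apply/row_matrixP => i; rewrite row_mul !row_rho total_actM to_rho.
Qed.

Lemma rho1 : rho 1%g = 1%:M.
Proof. by apply/row_matrixP => i; rewrite row_rho total_act1 row1. Qed.

Lemma rhoV a : rho a^-1%g = (rho a)^T.
Proof.
have := rhoM a^-1 a; rewrite mulVg rho1 => /(congr1 (mulmx^~ (rho a)^T)).
by rewrite -mulmxA rho_orthogonal mul1mx mulmx1.
Qed.

Lemma rhoX a k : rho (a ^+ k)%g = rho a ^+ k.
Proof. by elim: k => [|k IH]; rewrite ?rho1// expgS rhoM IH exprS. Qed.

Hypothesis free : free_action to.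

Lemma rho_sub1_unit a : a != 1%g -> rho a - 1 \in unitmx.
Proof.
move=> a1; rewrite -row_free_unit; apply: inj_row_free => v.
rewrite mulmxBr mulmx1 => /eqP; rewrite subr_eq0 => /eqP va.
have [//|/sphere_normalize[k [k0 kv]]] := eqVneq v 0.
case/eqP: a1; apply: (@free a (mks kv)); apply/val_inj.
by rewrite to_rho /= -scalemxAl va.
Qed.

(** The average of the powers of [z] is the projection to the fixed vectors
    of [z]. *)
Lemma sum_rho_powers z : z != 1%g -> \sum_(j < #[z]%g) rho z ^+ j = 0.
Proof.
move=> z1; have := subrX1 (rho z) #[z]%g.
rewrite -rhoX expg_order rho1 subrr => /esym/eqP H.
have U := rho_sub1_unit z1.
have -> : \sum_(j < #[z]%g) rho z ^+ j =
   (rho z - 1)^-1 * ((rho z - 1) * \sum_(j < #[z]%g) rho z ^+ j).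
  by rewrite mulrA mulVr ?mul1r.
by rewrite (eqP H) mulr0.
Qed.

(** Since the powers of [z] have average 0, their traces cannot all be close to
    that of the identity. *)
Lemma no_small_powers z :
  (forall j, fro (rho z ^+ j - 1%:M) < 1) -> z = 1%g.
Proof.
move=> small; apply/eqP/negPn/negP => z1.
have : \sum_(j < #[z]%g) fro (rho z ^+ j - 1%:M) = 2 * (#[z]%g)%:R * n.+1%:R.
  under eq_bigr do rewrite -rhoX fro_orthogonal_sub1 ?rho_orthogonal//.
  rewrite -mulr_sumr -mulrA -raddf_sum /=; congr (2 * _).
  rewrite sumrB /=; under [X in _ - X]eq_bigr do rewrite rhoX.
  rewrite sum_rho_powers// subr0 raddf_sum /= sumr_const card_ord mxtrace1.
  by rewrite mulr_natl.
apply/eqP; rewrite lt_eqF//.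
apply: (@lt_le_trans _ _ (\sum_(j < #[z]%g) 1)).
  apply: ltr_sum => [|j _]; last exact: small.
  by rewrite has_predT /index_enum -enumT size_enum_ord order_gt0.
rewrite sumr_const card_ord -[X in X <= _]mulr1 -mulrA (mulrC 2) -mulrA.
rewrite -mulr_natl mulr1 ler_peMr ?ler0n//.
have : 1 <= n.+1%:R :> R by rewrite ler1n.
by lra.
Qed.

(** Below 1 / 4, commutators get closer to the identity
    ([fro_commutator_le]), and the product of two such elements meets the
    hypothesis of [no_small_powers]. *)
Definition near1 a := fro (rho a - 1%:M) < 4^-1.

Lemma fro_conj a b : fro (rho (a * b * a^-1)%g - 1%:M) = fro (rho b - 1%:M).
Proof.
have -> : rho (a * b * a^-1)%g - 1%:M = rho a *m ((rho b - 1%:M) *m rho a^-1).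
  rewrite mulmxBl mul1mx mulmxBr !rhoM -mulmxA; congr (_ - _).
  by rewrite -rhoM mulgV rho1.
by rewrite fro_mulmxl ?fro_mulmxr ?rho_orthogonal.
Qed.

Lemma fro_commutator_le a b :
  fro (rho (a * b * a^-1 * b^-1)%g - 1%:M) <=
  4 * fro (rho a - 1%:M) * fro (rho b - 1%:M).
Proof.
set X := rho a - 1%:M; set Y := rho b - 1%:M.
have -> : rho (a * b * a^-1 * b^-1)%g - 1%:M =
    (X *m Y + - (Y *m X)) *m rho (a^-1 * b^-1)%g.
  have -> : X *m Y + - (Y *m X) = rho (a * b)%g - rho (b * a)%g.
    rewrite /X /Y !mulmxBr !mulmxBl !mul1mx !mulmx1 -!rhoM.
    by apply/matrixP => i j; rewrite !mxE; ring.
  by rewrite mulmxBl -!rhoM !mulgA mulgK mulgV rho1.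
rewrite fro_mulmxr ?rho_orthogonal//; apply: le_trans (froD_le _ _) _.
by rewrite froN; have := froM_le X Y; have := froM_le Y X; lra.
Qed.

(** If [z = [a, b]] commutes with [a] then [a ^+ j] conjugates [b] to
    [z ^+ j * b]; so all powers of [z] are products of two elements as close to
    the identity as [b], which forces [z = 1]. As the commutator of [a] and [b]
    is closer to the identity than [b], it may be assumed to commute with [a]. *)
Lemma near1_commute a b : near1 a -> near1 b -> commute a b.
Proof.
move=> na nb; apply/eqP/negPn/negP => nab.
have /= := @arg_minP _ _ _ b
  [pred b | near1 b && (a * b != b * a)%g] (fun b => fro (rho b - 1%:M)).
rewrite nb nab => /(_ isT) [{nb nab} b /andP[nb nab] minb].
set z := (a * b * a^-1 * b^-1)%g.
have zb : (a * b * a^-1 = z * b)%g by rewrite /z mulgKV.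
have b0 : 0 < fro (rho b - 1%:M).
  rewrite lt_neqAle fro_ge0 andbT eq_sym; apply: contraNneq nab => /fro_eq0.
  move=> /eqP; rewrite subr_eq0 => /eqP rb; have [->|b1] := eqVneq b 1%g.
    by rewrite mulg1 mul1g.
  by have := rho_sub1_unit b1; rewrite rb subrr unitr0.
have ltz : fro (rho z - 1%:M) < fro (rho b - 1%:M).
  apply: le_lt_trans (fro_commutator_le a b) _.
  rewrite -[X in _ < X]mul1r ltr_pM2r// mulrC -ltr_pdivlMr// mul1r.
  exact: na.
have az : commute a z.
  apply/eqP/negPn/negP => naz; have := minb z.
  by rewrite /= naz andbT /near1 (lt_trans ltz nb) leNgt ltz => /(_ isT).
have conj j : (a ^+ j * b * a ^- j = z ^+ j * b)%g.
  elim: j => [|j IH]; first by rewrite !expg0 invg1 mulg1.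
  have -> : (a ^+ j.+1 * b * a ^- j.+1 = a ^+ j * (a * b * a^-1) * a ^- j)%g.
    by rewrite expgSr invMg !mulgA.
  by rewrite zb mulgA -(commuteX j (commute_sym az)) -!mulgA (mulgA (a ^+ j)%g)
    IH expgS !mulgA.
have z1 : z = 1%g.
  apply: no_small_powers => j; rewrite -rhoX.
  have -> : fro (rho (z ^+ j)%g - 1%:M) =
      fro ((rho (z ^+ j * b)%g - 1%:M) + - (rho b - 1%:M)).
    rewrite -(fro_mulmxr _ (rho_orthogonal b)) mulmxBl mul1mx -rhoM.
    by congr fro; rewrite opprB addrA addrNK.
  apply: le_lt_trans (froD_le _ _) _; rewrite froN -conj fro_conj.
  by move: nb; rewrite /near1; lra.
by case/eqP: nab; rewrite -[RHS]mul1g -z1 /z !mulgA mulgKV mulgKV.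
Qed.

Definition near1_group : {group gT} := <<finset near1>>%G.

Lemma near1_group_abelian : abelian near1_group.
Proof.
rewrite abelian_gen; apply/centsP => a; rewrite inE => na b; rewrite inE => nb.
exact: near1_commute.
Qed.

Lemma near1_group_normal : normal near1_group [set: gT]%SET.
Proof.
rewrite /normal finset.subsetT /= norms_gen//; apply/fintype.subsetP => a _.
apply/normP/setP => b; rewrite mem_conjg !inE /near1.
by rewrite conjgE invgK mulgA fro_conj.
Qed.

Lemma near1_group_cyclic : cyclic near1_group.
Proof.
apply: (@div_ring_mul_group_cyclic _ _ 'M[R]_n.+1 rho) near1_group_abelian.
- exact: rho1.
- by move=> a b _ _; exact: rhoM.
- by move=> a /setD1P[a1 _]; exact: rho_sub1_unit.
Qed.

(** The entries of an orthogonal matrix lie between -1 and 1; this interval is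
    cut in pieces of length 1 / (4 (n + 1)), so that the squares of the
    differences of (n + 1)^2 pairs of entries in common pieces add up to at most
    1 / 16. The last index stands for the entries equal to 1. *)
Definition grid_fineness := (4 * n.+1)%N.
Definition grid a : {ffun 'I_n.+1 * 'I_n.+1 -> 'I_(grid_fineness + grid_fineness).+1} :=
  [ffun ij => inord (Num.truncn ((rho a ij.1 ij.2 + 1) * grid_fineness%:R))].

Lemma rho_entry_bound a i j : -1 <= rho a i j <= 1.
Proof.
have -> : rho a i j = dot (row i (rho a)) (delta_mx 0 j) by rewrite dot_delta [RHS]mxE.
apply: unit_dot_bound; last exact: dot_delta_delta.
by rewrite row_rho sphere_dot.
Qed.

Lemma grid_near1 a b : grid a = grid b -> near1 (a * b^-1)%g.
Proof.
move=> ab; rewrite /near1.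
have -> : fro (rho (a * b^-1)%g - 1%:M) = fro (rho a - rho b).
  by rewrite -(fro_mulmxr _ (rho_orthogonal b)) mulmxBl mul1mx -rhoM mulgKV.
pose N : R := grid_fineness%:R.
have N0 : 0 < N by rewrite ltr0n.
have entry i j : (rho a - rho b) i j ^+ 2 <= N^-1 ^+ 2.
  have := congr1 (fun f : {ffun _ -> _} => val (f (i, j))) ab; rewrite !ffunE /=.
  have tr c : 0 <= (rho c i j + 1) * N /\ (Num.truncn ((rho c i j + 1) * N) < (grid_fineness + grid_fineness).+1)%N.
    have /andP[ge le] := rho_entry_bound c i j.
    have p0 : 0 <= (rho c i j + 1) * N by apply: mulr_ge0; [lra|exact: ltW].
    split=> //; rewrite ltnS -(ler_nat R); have /andP[tr _] := truncn_itv p0.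
    by apply: le_trans tr _; rewrite natrD -/N; nra.
  have [a0 la] := tr a; have [b0 lb] := tr b.
  rewrite !inordK// => e; have := truncn_itv a0; have := truncn_itv b0.
  rewrite e -natr1 => /andP[b1 b2] /andP[a1 a2].
  have H : `|rho a i j - rho b i j| * N <= 1.
    rewrite -[X in _ * X](gtr0_norm N0) -normrM ler_norml mulrBl.
    by apply/andP; split; lra.
  have -> : (rho a - rho b) i j = rho a i j - rho b i j.
    by rewrite [LHS]mxE [X in _ + X]mxE.
  rewrite -real_normK ?num_real//.
  rewrite ler_pXn2r ?nnegrE ?invr_ge0 ?(ltW N0)//.
  by rewrite -[X in _ <= X]mul1r ler_pdivlMr.
apply: (@le_lt_trans _ _ (\sum_(i < n.+1) \sum_(j < n.+1) N^-1 ^+ 2)).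
  by apply: ler_sum => i _; apply: ler_sum.
rewrite !sumr_const card_ord -mulrnA -[X in X < _]mulr_natl.
have -> : N = 4 * n.+1%:R by rewrite /N natrM.
rewrite natrM; set k := n.+1%:R; have k0 : 0 < k :> R by rewrite ltr0n.
have -> : k * k * (4 * k)^-1 ^+ 2 = 16^-1 by field; rewrite gt_eqF.
lra.
Qed.

Definition index_bound := ((grid_fineness + grid_fineness).+1 ^ (n.+1 * n.+1))%N.

Lemma near1_group_index : (#|[set: gT]%SET : near1_group|%g <= index_bound)%N.
Proof.
rewrite /indexg -(card_in_imset (f := grid \o repr)).
  by apply: leq_trans (max_card _) _; rewrite card_ffun card_prod !card_ord.
move=> C D /rcosetsP[c _ ->] /rcosetsP[d _ ->] /= /grid_near1 cd.
have /rcosetP[x Ax rx] := mem_repr_rcoset near1_group c.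
have /rcosetP[y Ay ry] := mem_repr_rcoset near1_group d.
apply/rcoset_eqP; rewrite mem_rcoset.
have : (repr (near1_group :* c) * (repr (near1_group :* d))^-1)%g \in near1_group.
  by apply: mem_gen; rewrite inE.
rewrite rx ry invMg -!mulgA groupMl// (mulgA c) groupMr//.
by rewrite groupV.
Qed.

End Representation.

(** * Continuity for row vectors and the sphere *)

Section Continuity.
Variable R : realType.

Lemma continuous_sumr (T : topologicalType) (V : normedModType R) (I : finType)
    (f : I -> T -> V) :
  (forall i, continuous (f i)) -> continuous (fun t => \sum_i f i t).
Proof.
move=> cf; apply: (@continuous_big V I +%R 0 xpredT) => [|i _]; last exact: cf.
exact: add_continuous.
Qed.

Lemma continuous_rV (T : topologicalType) m (f : T -> 'rV[R]_m) :
  (forall i, continuous (fun t => f t 0 i)) -> continuous f.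
Proof.
move=> cf; have -> : f = fun t => \sum_i f t 0 i *: delta_mx 0 i.
  by apply/funext => t; exact: row_sum_delta.
apply: (continuous_sumr (f := fun i t => f t 0 i *: delta_mx 0 i)) => i x.
exact/continuousZr_tmp/cf.
Qed.

Lemma continuous_dot (T : topologicalType) m (f g : T -> 'rV[R]_m) :
  continuous f -> continuous g -> continuous (fun t => dot (f t) (g t)).
Proof.
move=> cf cg.
apply: (continuous_sumr (f := fun i t => f t 0 i * g t 0 i)) => i x.
have cc (h : T -> 'rV[R]_m) : continuous h -> {for x, continuous (fun t => h t 0 i)}.
  move=> ch; apply: (@continuous_comp _ _ _ h (fun y : 'rV[R]_m => y 0 i)).
    exact: ch.
  exact: coord_continuous.
by apply: continuousM; exact: cc.
Qed.

Lemma continuous_mulmxr m k (M : 'M[R]_(m, k)) :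
  continuous (fun x : 'rV[R]_m => x *m M).
Proof.
apply: continuous_rV => i.
have -> : (fun x : 'rV[R]_m => (x *m M) 0 i) = fun x => dot x (col i M)^T.
  by apply/funext => x; rewrite mxE; apply: eq_bigr => j _; rewrite !mxE.
apply: (continuous_dot (f := id) (g := cst (col i M)^T)) => x.
  exact: cvg_id.
exact: cst_continuous.
Qed.

Variable n : nat.

Lemma closed_sphere : closed (sphere R n).
Proof.
have -> : sphere R n = (fun x => dot x x) @^-1` [set 1] by [].
apply: preimage_closed; last exact: closed_eq.
move=> x _; apply: (continuous_dot (f := id) (g := id)) => y; exact: cvg_id.
Qed.

Lemma compact_sphere : compact (sphere R n).
Proof.
apply: bounded_closed_compact closed_sphere.
exists 1; split; first by rewrite num_real.
move=> r r1 x x1; rewrite /= [leLHS]/Num.Def.normr /= mx_normrE.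
apply/bigmax_leP; split=> [|[i j] _ /=]; first by apply: ltW; lra.
rewrite (ord1 i) -dot_delta.
apply: le_trans (ltW r1); rewrite ler_norml; apply: unit_dot_bound => //.
exact: dot_delta_delta.
Qed.

Lemma sphere_nonempty : sphere R n !=set0.
Proof. by exists (delta_mx 0 0); exact: dot_delta_delta. Qed.

End Continuity.

(** * Invariant planes of orthogonal matrices *)

Section InvariantPlane.
Variables (R : realType) (n : nat).
Implicit Types (M : 'M[R]_n.+1) (x v : 'rV[R]_n.+1).

(** The first variation at a maximum of the quadratic form of [M] on the
    sphere vanishes. *)
Lemma symmetric_part_eigenvector M :
  exists x c, dot x x = 1 /\ x *m (M + M^T) = c *: x.
Proof.
have [|x] := @EVT_max_rV R _ (fun x => dot x (x *m M)) _
  (sphere_nonempty R n) (@compact_sphere R n).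
  apply: continuous_subspaceT.
  apply: (continuous_dot (f := id) (g := mulmx^~ M)) => [x|].
    exact: cvg_id.
  exact: continuous_mulmxr.
rewrite inE => x1 maxx; set l := dot x (x *m M) in maxx.
have {}maxx y : dot y (y *m M) <= l * dot y y.
  have [->|/sphere_normalize[k [k0 ky]]] := eqVneq y 0.
    by rewrite !dot0l mulr0.
  have := maxx _ (mem_set ky); move: ky; rewrite /sphere /= -scalemxAl !dot_lin.
  have k2 : 0 < k * k by rewrite -expr2 exprn_even_gt0.
  move=> ky H; rewrite -(ler_pM2l k2) mulrCA -(mulrA k k (dot y y)) ky mulr1.
  by rewrite -mulrA.
set u := x *m (M + M^T).
have var v : dot v x = 0 -> dot v u = 0.
  move=> vx; have vu : dot v u = dot x (v *m M) + dot v (x *m M).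
    by rewrite /u mulmxDr dotDr -(dot_mulmx v) (dotC (v *m M)) addrC.
  set L := dot v u; pose K := l * dot v v - dot v (v *m M).
  have H t : t * L <= t ^+ 2 * K.
    have := maxx (x + t *: v); rewrite mulmxDl -scalemxAl !dot_lin x1 vx (dotC x v) vx.
    by rewrite -/l /L vu /K; nra.
  have k1 : 0 < 1 + `|K| by rewrite ltr_pwDl.
  have := H (L / (1 + `|K|)); have Kn := ler_norm K.
  have -> : L / (1 + `|K|) * L = L ^+ 2 * (1 + `|K|) / (1 + `|K|) ^+ 2.
    by field; rewrite gt_eqF.
  have -> : (L / (1 + `|K|)) ^+ 2 * K = L ^+ 2 * K / (1 + `|K|) ^+ 2.
    by field; rewrite gt_eqF.
  rewrite ler_pM2r ?invr_gt0 ?exprn_gt0// => HL; apply/eqP.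
  by rewrite -sqrf_eq0; apply/eqP; have := sqr_ge0 L; nra.
exists x, (dot u x); split=> //; apply/eqP; rewrite -subr_eq0; apply/eqP.
have vx : dot (u - dot u x *: x) x = 0 by rewrite !dot_lin x1 mulr1 subrr.
apply: dot_eq0; rewrite dotDr (var _ vx) dotNr dotZr vx; ring.
Qed.

Lemma orthogonal_invariant_plane M : M *m M^T = 1%:M ->
  exists E : 'M[R]_(1 + 1, n.+1), [/\ stablemx E M & (0 < \rank E <= 2)%N].
Proof.
move=> MM; have [x [c [x1 xc]]] := symmetric_part_eigenvector M.
exists (col_mx x (x *m M)); split.
  rewrite mul_col_mx col_mx_sub; apply/andP; split.
    by rewrite -addsmxE addsmxSr.
  have -> : x *m M *m M = c *: (x *m M) - x.
    have := congr1 (mulmx^~ M) xc; rewrite mulmxDr mulmxDl -scalemxAl.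
    by rewrite -(mulmxA x M^T) (mulmx1C MM) mulmx1 => <-; rewrite addrK.
  apply: addmx_sub.
    by rewrite scalemx_sub// -addsmxE addsmxSr.
  by rewrite -scaleN1r scalemx_sub// -addsmxE addsmxSl.
rewrite rank_leq_row andbT lt0n mxrank_eq0; apply/eqP => E0.
have := congr1 usubmx E0; rewrite col_mxKu linear0 => x0.
by move: x1; rewrite x0 dot0l; lra.
Qed.

End InvariantPlane.

(** * Topology of the quotients of the sphere *)

Section Quotient.
Variables (R : realType) (n : nat) (gT : finGroupType).
Variable to : {action gT &-> sphere R n}.

Lemma space_form_projP (x y : sphere R n) :
  space_form_proj to x = space_form_proj to y <-> exists a, to x a = y.
Proof.
rewrite /space_form_proj; split=> [/eqmodP /existsP[a /eqP]|[a xa]].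
  by exists a.
by apply/eqmodP/existsP; exists a; rewrite xa.
Qed.

Lemma space_form_proj_act x a : space_form_proj to (to x a) = space_form_proj to x.
Proof. by apply/esym/space_form_projP; exists a. Qed.

Definition space_form_repr (X : space_form to) : sphere R n :=
  generic_quotient.repr (X : quotient_topology {eq_quot (same_orbit to)}).

Lemma space_form_reprK : cancel space_form_repr (space_form_proj to).
Proof. by move=> X; exact: generic_quotient.reprK. Qed.

Lemma space_form_proj_continuous : continuous (space_form_proj to).
Proof. exact: pi_continuous. Qed.

Lemma space_form_continuous (T : topologicalType) (f : space_form to -> T) :
  continuous (f \o space_form_proj to) -> continuous f.
Proof. by move=> cf; apply/quotient_continuous. Qed.

Hypothesis iso : isometric_action to.

Lemma val_continuous : continuous (\val : sphere R n -> 'rV[R]_n.+1).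
Proof. exact: initial_continuous. Qed.

Lemma sphere_continuous (T : topologicalType) (f : T -> sphere R n) :
  continuous (fun t => \val (f t)) -> continuous f.
Proof. exact: (@continuous_comp_initial _ _ _ (set_val : sphere R n -> _)). Qed.

Lemma to_continuous a : continuous (to^~ a).
Proof.
apply: sphere_continuous.
have -> : (fun t => \val (to t a)) = mulmx^~ (rho to a) \o (\val : sphere R n -> _).
  by apply/funext => x; rewrite /= to_rho.
move=> x; apply: continuous_comp; first exact: val_continuous.
exact: continuous_mulmxr.
Qed.

Lemma open_act a (U : set (sphere R n)) : open U -> open [set to x a | x in U].
Proof.
move=> oU; have -> : [set to x a | x in U] = to^~ (a^-1)%g @^-1` U.
  apply/seteqP; split=> [_ [x Ux <-]|x Ux] /=; first by rewrite total_actK.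
  by exists (to x a^-1%g) => //; rewrite -{2}(invgK a) total_actK.
by apply: open_comp => // x _; exact: to_continuous.
Qed.

Lemma open_proj (U : set (sphere R n)) : open U -> open (space_form_proj to @` U).
Proof.
move=> oU; rewrite /open /= /quotient_open.
have -> : \pi_(quotient_topology {eq_quot same_orbit to}) @^-1`
    (space_form_proj to @` U) = \bigcup_(a in [set: gT]) [set to x a | x in U].
  apply/seteqP; split=> [y [x Ux /space_form_projP[a <-]]|_ [a _ [x Ux <-]]].
    by exists a => //; exists x.
  by exists x => //; rewrite [RHS]space_form_proj_act.
by apply: bigcup_open => a _; exact: open_act.
Qed.

Hypothesis free : free_action to.

Definition separating (O : set (sphere R n)) :=
  forall y z a, O y -> O z -> a != 1%g ->
    dot (\val y) (\val (to z a)) < dot (\val y) (\val z).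

(** The strict inequality holds at [y = z = x], since [to x a] differs from [x];
    by continuity it persists nearby. *)
Lemma exists_separating (x : sphere R n) :
  exists O : set (sphere R n), [/\ open O, O x & separating O].
Proof.
pose D a (yz : sphere R n * sphere R n) :=
  dot (\val yz.1) (\val yz.2) - dot (\val yz.1) (\val (to yz.2 a)).
have cD a : continuous (D a).
  have c1 : continuous (fun yz : sphere R n * sphere R n => \val yz.1).
    by move=> u; apply: continuous_comp; [exact: cvg_fst|exact: val_continuous].
  have c2 : continuous (fun yz : sphere R n * sphere R n => \val yz.2).
    by move=> u; apply: continuous_comp; [exact: cvg_snd|exact: val_continuous].
  have c3 : continuous (fun yz : sphere R n * sphere R n => \val (to yz.2 a)).
    move=> u; apply: (@continuous_comp _ _ _ (fun yz => yz.2) (fun z => \val (to z a))).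
      exact: cvg_snd.
    apply: (@continuous_comp _ _ _ (to^~ a) \val); first exact: to_continuous.
    exact: val_continuous.
  move=> u; exact: (cvgB (continuous_dot c1 c2 (x := u)) (continuous_dot c1 c3 (x := u))).
have D0 a : a != 1%g -> 0 < D a (x, x).
  move=> a1; rewrite subr_gt0 /= sphere_dot lt_neqAle.
  have /andP[_ ->] := sphere_dot_bound x (to x a); rewrite andbT.
  apply: contra_neq a1 => xa; apply: (@free a x); apply/val_inj.
  apply/eqP; rewrite -subr_eq0; apply/eqP/dot_eq0.
  by rewrite !dot_lin !sphere_dot (dotC (\val (to x a))) xa; ring.
have : nbhs (x, x) [set yz | forall a, a != 1%g -> 0 < D a yz].
  have FF : Filter (nbhs (x, x)) by exact: nbhs_filter.
  apply: (@filter_forall _ gT (fun a yz => a != 1%g -> 0 < D a yz) _ FF) => a.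
  have [->|a1] := eqVneq a 1%g.
    by apply: nearW => yz /eqP.
  have := @cvgr_gt _ _ _ FF _ _ (cD a (x, x)) _ (D0 a a1).
  by apply: (@filterS _ _ FF) => yz h _; exact: h.
move=> [[P Q] [/= Px Qx] sPQ].
exists (interior (P `&` Q)); split.
- exact: open_interior.
- by apply: filterI.
move=> y z a /interior_subset[Py _] /interior_subset[_ Qz] a1.
by have := sPQ (y, z) (conj Py Qz) a a1; rewrite /D subr_gt0.
Qed.

Lemma separating_proj_inj (O : set (sphere R n)) y z : separating O ->
  O y -> O z -> space_form_proj to y = space_form_proj to z -> y = z.
Proof.
move=> sO Oy Oz /space_form_projP[a ya]; have [a1|a1] := eqVneq a 1%g.
  by rewrite -ya a1 total_act1.
have := sO z y a Oz Oy a1; rewrite ya sphere_dot.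
by have /andP[_] := sphere_dot_bound z y; rewrite leNgt => /negPf ->.
Qed.

(** The infimum defining the distance of two points close to each other is
    attained at their representatives in a separating set. *)
Lemma space_form_dist_separating (O : set (sphere R n)) y z :
  separating O -> O y -> O z ->
  sphere_dist y z <=
    space_form_dist (space_form_proj to y) (space_form_proj to z).
Proof.
move=> sO Oy Oz; apply: lb_le_inf.
  by exists (sphere_dist y z), y, z.
move=> r [y' [z' [/space_form_projP[a ay] /space_form_projP[b bz] ->]]].
have -> : sphere_dist y' z' = sphere_dist y (to z (b^-1 * a)%g).
  by rewrite -(iso a) ay total_actM -bz total_actK.
rewrite sphere_dist_le; have [->|c1] := eqVneq (b^-1 * a)%g 1%g.
  by rewrite total_act1.
exact/ltW/sO.
Qed.

Lemma space_form_dist_le x y :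
  space_form_dist (space_form_proj to x) (space_form_proj to y) <=
  sphere_dist x y.
Proof.
apply: ge_inf; last by exists x, y.
by exists 0 => r [y' [z' [_ _ ->]]]; exact: sphere_dist_ge0.
Qed.

End Quotient.

(** * The covering defined by a normal subgroup *)

Section SubgroupCovering.
Variables (R : realType) (n : nat) (gT : finGroupType).
Variable to : {action gT &-> sphere R n}.
Variable A : {group gT}.

Definition sub_act (x : sphere R n) (a : subg_of A) := to x (sgval a).

Lemma sub_act1 x : sub_act x 1%g = x.
Proof. exact: total_act1. Qed.

Lemma sub_actM x : act_morph sub_act x.
Proof. by move=> a b; rewrite /sub_act -total_actM. Qed.

Definition sub_action : {action subg_of A &-> sphere R n} :=
  TotalAction sub_act1 sub_actM.

Lemma sub_actionE x a : sub_action x a = to x (sgval a).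
Proof. by []. Qed.

Lemma sub_proj_eq x y : space_form_proj sub_action x = space_form_proj sub_action y <->
  exists2 a, a \in A & to x a = y.
Proof.
rewrite space_form_projP; split=> [[a <-]|[a Aa <-]].
  by exists (sgval a) => //; exact: subgP.
by exists (subg A a); rewrite sub_actionE subgK.
Qed.

Lemma sub_isometric : isometric_action to -> isometric_action sub_action.
Proof. by move=> iso a x y; exact: iso. Qed.

Definition cover_proj (X : space_form sub_action) : space_form to :=
  space_form_proj to (space_form_repr X).

Lemma cover_projE x :
  cover_proj (space_form_proj sub_action x) = space_form_proj to x.
Proof.
have : space_form_proj sub_action x =
    space_form_proj sub_action (space_form_repr (space_form_proj sub_action x)).
  by rewrite space_form_reprK.
by case/sub_proj_eq=> a _ xa; rewrite /cover_proj -xa space_form_proj_act.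
Qed.

Hypothesis iso : isometric_action to.
Hypothesis free : free_action to.

Lemma cover_fibreP x (Z : space_form sub_action) :
  cover_proj Z = space_form_proj to x <->
  exists a, Z = space_form_proj sub_action (to x a).
Proof.
split=> [|[a ->]]; last by rewrite cover_projE space_form_proj_act.
rewrite -(space_form_reprK Z) cover_projE => /esym/space_form_projP[a xa].
by exists a; rewrite xa.
Qed.

Lemma cover_continuous : continuous cover_proj.
Proof.
apply: space_form_continuous.
have -> : cover_proj \o space_form_proj sub_action = space_form_proj to.
  by apply/funext => x; rewrite /= cover_projE.
exact: space_form_proj_continuous.
Qed.

Lemma free_act_inj x a b : to x a = to x b -> a = b.
Proof.
move=> e; have /free/eqP : to x (a * b^-1)%g = x by rewrite total_actM e total_actK.
by rewrite -eq_mulgV1 => /eqP.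
Qed.

(** The sheets over the image of a separating set [O] around [x] are indexed by
    the fibre over the image of [x]: the sheet of [e] is the image of the
    translates [O a] with [x a] over [e]. *)
Lemma separating_evenly_covered (O : set (sphere R n)) x :
  open O -> O x -> separating to O ->
  evenly_covered cover_proj (space_form_proj to @` O).
Proof.
move=> oO Ox sO.
pose V (e : cover_proj @^-1` [set space_form_proj to x]) :=
  [set Z | exists a y, [/\ O y, space_form_proj sub_action (to x a) = \val e
                        & Z = space_form_proj sub_action (to y a)]].
exists _, V; split.
- move=> e; have -> : V e = \bigcup_(a in [set a | space_form_proj sub_action (to x a) = \val e])
      (space_form_proj sub_action @` [set to y a | y in O]).
    apply/seteqP; split=> [Z [a [y [Oy xe ->]]]|Z [a xe [_ [y Oy <-] <-]]].
      by exists a => //; exists (to y a) => //; exists y.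
    by exists a, y.
  apply: bigcup_open => a _; apply: open_proj; first exact: sub_isometric.
  exact: open_act.
- apply/trivIsetP => e e' _ _; apply: contra_neqP => /eqP/set0P[Z].
  move=> [[a [y [Oy xe ->]]] [a' [y' [Oy' xe' /sub_proj_eq[b Ab yb]]]]].
  apply/val_inj; rewrite -xe -xe'.
  have yy : y = y'.
    apply: (separating_proj_inj sO Oy Oy').
    apply/space_form_projP; exists (a * b * a'^-1)%g.
    by rewrite !total_actM yb total_actK.
  have ab : (a * b)%g = a' by apply: (@free_act_inj y); rewrite total_actM yb yy.
  by apply/sub_proj_eq; exists b => //; rewrite -ab total_actM.
- apply/seteqP; split=> [Z [y Oy]|Z [e _ [a [y [Oy xe ->]]]]].
    move=> /esym/cover_fibreP[a ->].
    have ex : (cover_proj @^-1` [set space_form_proj to x])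
        (space_form_proj sub_action (to x a)).
      by rewrite /= cover_projE space_form_proj_act.
    pose e : cover_proj @^-1` [set space_form_proj to x] :=
      exist (fun Z => Z \in cover_proj @^-1` [set space_form_proj to x]) _ (mem_set ex).
    by exists e => //; exists a, y.
  by exists y => //; rewrite cover_projE space_form_proj_act.
- move=> e; have /cover_fibreP[a ea] : cover_proj (\val e) = space_form_proj to x.
    exact: (set_valP e).
  pose lift (u : space_form to) := xget x [set y | O y /\ space_form_proj to y = u].
  have liftE y : O y -> lift (space_form_proj to y) = y.
    move=> Oy; rewrite /lift; case: xgetP => [z _ [Oz zy]|/(_ y)]; last by case.
    exact: (separating_proj_inj sO).
  exists (fun u => space_form_proj sub_action (to (lift u) a)); split.
  + have oU := open_proj iso oO.
    rewrite continuous_open_subspace//; apply/continuous_inP => // W oW.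
    have -> : space_form_proj to @` O `&`
        (fun u => space_form_proj sub_action (to (lift u) a)) @^-1` W =
        space_form_proj to @` (O `&` (fun y => space_form_proj sub_action (to y a)) @^-1` W).
      apply/seteqP; split=> [_ [[y Oy <-] /=]|_ [y [Oy /= Wy] <-]].
        by rewrite liftE// => Wy; exists y.
      by split; [exists y|rewrite /= liftE].
    apply: open_proj => //; apply: openI => //.
    apply: open_comp => // y _; apply: continuous_comp; first exact: to_continuous.
    exact: space_form_proj_continuous.
  + move=> _ [y Oy <-]; rewrite liftE// cover_projE space_form_proj_act; split=> //.
    by exists a, y; rewrite ea.
  + move=> _ [a' [y [Oy xe ->]]].
    rewrite cover_projE space_form_proj_act liftE//.
    have /sub_proj_eq[b Ab ab] : space_form_proj sub_action (to x a) =
      space_form_proj sub_action (to x a') by rewrite xe ea.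
    have {}ab : (a * b)%g = a' by apply: (@free_act_inj x); rewrite total_actM.
    by apply/sub_proj_eq; exists b => //; rewrite -ab total_actM.
Qed.

Lemma cover_covering : covering cover_proj.
Proof.
split=> [||b]; first exact: cover_continuous.
  apply/seteqP; split=> // b _; exists (space_form_proj sub_action (space_form_repr b)) => //.
  by rewrite cover_projE space_form_reprK.
have [U [oU Ux sU]] := exists_separating iso free (space_form_repr b).
exists (space_form_proj to @` U); split; first exact: open_proj.
  by exists (space_form_repr b) => //; rewrite space_form_reprK.
exact: separating_evenly_covered Ux sU.
Qed.

Hypothesis nA : normal A [set: gT]%SET.

Lemma conj_mem a b : b \in A -> (a^-1 * b * a)%g \in A.
Proof.
by move=> Ab; rewrite -mulgA -conjgE memJ_norm// (fintype.subsetP (normal_norm nA)).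
Qed.

(** As [A] is normal, [a] permutes the orbits of [A]. *)
Definition deck (a : gT) (X : space_form sub_action) : space_form sub_action :=
  space_form_proj sub_action (to (space_form_repr X) a).

Lemma deckE a x :
  deck a (space_form_proj sub_action x) = space_form_proj sub_action (to x a).
Proof.
have /sub_proj_eq[b Ab xb] : space_form_proj sub_action x =
    space_form_proj sub_action (space_form_repr (space_form_proj sub_action x)).
  by rewrite space_form_reprK.
apply/esym/sub_proj_eq; exists (a^-1 * b * a)%g; first exact: conj_mem.
by rewrite -xb -!total_actM !mulgA mulgV mul1g.
Qed.

Lemma deckK a : cancel (deck a) (deck a^-1%g).
Proof.
by move=> X; rewrite -(space_form_reprK X) !deckE total_actK.
Qed.

Lemma deck_continuous a : continuous (deck a).
Proof.
apply: space_form_continuous.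
have -> : deck a \o space_form_proj sub_action = space_form_proj sub_action \o to^~ a.
  by apply/funext => x; rewrite /= deckE.
move=> x; apply: continuous_comp; first exact: to_continuous.
exact: space_form_proj_continuous.
Qed.

Lemma deck_deck_transformation a : deck_transformation cover_proj (deck a).
Proof.
split; first exact: deck_continuous.
  apply/funext => X; rewrite -(space_form_reprK X) /= deckE !cover_projE.
  exact: space_form_proj_act.
exists (deck a^-1%g); split; [exact: deck_continuous|exact: deckK|].
by rewrite -{2}(invgK a); exact: deckK.
Qed.

Lemma cover_normal_covering :
  connected [set: space_form sub_action] -> normal_covering cover_proj.
Proof.
move=> cE; split=> //; first exact: cover_covering.
move=> X Y; rewrite -(space_form_reprK X) cover_projE => /esym/cover_fibreP[a ->].
by exists (deck a); split; [exact: deck_deck_transformation|rewrite deckE].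
Qed.

Lemma cover_order : covering_order cover_proj #|[set: gT]%SET : A|%g.
Proof.
move=> b; set x := space_form_repr b.
rewrite -card_lcosets; set L := lcosets A [set: gT]%SET.
pose C k := nth finset.set0 (enum L) k.
pose f k := space_form_proj sub_action (to x (fingroup.repr (C k))).
have CL k : (k < #|L|)%N -> C k \in L.
  by rewrite cardE => kL; rewrite -mem_enum; exact: mem_nth.
have Crepr k : (k < #|L|)%N -> C k = (fingroup.repr (C k) *: A)%g.
  move=> /CL /lcosetsP[a _ ->]; apply/esym/lcoset_eqP.
  by apply: (mem_repr a); exact: lcoset_refl.
have -> : cover_proj @^-1` [set b] = f @` `I_#|L|.
  apply/seteqP; split=> [Z|_ [k kL <-]] /=; last first.
    by rewrite /f cover_projE space_form_proj_act space_form_reprK.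
  rewrite -[b]space_form_reprK => /cover_fibreP[a ->].
  have aL : (a *: A)%g \in enum L.
    by rewrite mem_enum; apply/lcosetsP; exists a => //; rewrite finset.inE.
  have kL : (index (a *: A)%g (enum L) < #|L|)%N by rewrite cardE index_mem.
  exists (index (a *: A)%g (enum L)) => //.
  rewrite /f /C nth_index//; apply/esym/sub_proj_eq.
  have /lcosetP[c Ac ->] : fingroup.repr (a *: A)%g \in (a *: A)%g.
    by apply: (mem_repr a); exact: lcoset_refl.
  by exists c => //; rewrite total_actM.
apply: inj_card_eq => i j; rewrite !inE => iL jL /sub_proj_eq[c Ac].
rewrite -total_actM => /free_act_inj ij.
have Cij : C i = C j.
  by rewrite (Crepr i)// (Crepr j)// -ij; apply/esym/lcoset_eqP; rewrite mem_lcoset mulKg.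
by apply/eqP; rewrite -(nth_uniq finset.set0 _ _ (enum_uniq L)) -?cardE//; apply/eqP.
Qed.

End SubgroupCovering.

(** * Lengths of curves *)

Section Curves.
Variables (R : realType) (n : nat) (gT : finGroupType).
Variable to : {action gT &-> sphere R n}.
Variable A : {group gT}.
Hypothesis iso : isometric_action to.
Hypothesis free : free_action to.

Local Notation E := (space_form (sub_action to A)).
Local Notation projE := (space_form_proj (sub_action to A)).
Local Notation distB := (@space_form_dist R n gT to).
Local Notation p := (@cover_proj R n gT to A).

Definition close_lifts (X Y : E) := exists y z,
  [/\ projE y = X, projE z = Y & sphere_dist y z <= distB (p X) (p Y)].

Lemma close_lifts_near (X : E) :
  exists U : set E, [/\ open U, U X & forall Y Z, U Y -> U Z -> close_lifts Y Z].
Proof.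
have [V [oV Vx sV]] := exists_separating iso free (space_form_repr X).
exists (projE @` V); split; first exact: (open_proj (sub_isometric (A := A) iso)).
  by exists (space_form_repr X) => //; exact: space_form_reprK.
move=> _ _ [y Vy <-] [z Vz <-]; exists y, z; split=> //.
by rewrite !cover_projE; exact: space_form_dist_separating sV Vy Vz.
Qed.

Lemma close_lifts_uniform (c : R -> E) : {within `[0, 1], continuous c} ->
  exists N : nat, forall s t, `[0, 1]%classic s -> `[0, 1]%classic t ->
    `|s - t| <= N.+1%:R^-1 -> close_lifts (c s) (c t).
Proof.
move=> /subspace_continuousP cc.
have /compact_near_coveringP/near_covering_withinP cov := @segment_compact R 0 1.
have := cov nat \oo (fun N s => forall t, `[0, 1]%classic t ->
    `|s - t| <= N.+1%:R^-1 -> close_lifts (c s) (c t)) _.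
case=> [t0 t01|N _ HN]; last first.
  by exists N => s t s01 t01 st; exact: (HN N (leqnn N) s s01).
have [U [oU Ut0 cU]] := close_lifts_near (c t0).
have /nbhs_ballP[e /= e0 ball_e] : within `[0, 1] (nbhs t0) (c @^-1` U).
  by apply: (cc _ t01); apply: open_nbhs_nbhs.
near=> s N => /= s01 t t01' st.
have ss : `|t0 - s| < e / 2 by near: s; apply: nbhsx_ballx; rewrite divr_gt0.
have sN : N.+1%:R^-1 < e / 2 by near: N; apply: near_infty_natSinv_lt (PosNum (divr_gt0 e0 _)).
apply: cU; apply: ball_e => //; rewrite /ball /=; first by lra.
have -> : t0 - t = (t0 - s) + (s - t) by ring.
have st' := le_lt_trans st sN.
by apply: le_lt_trans (ler_normD _ _) _; lra.
Unshelve. all: by end_near. Qed.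

Definition uniform_partition (N : nat) : seq R :=
  [seq i.+1%:R / N.+1%:R | i <- iota 0 N.+1].

Lemma uniform_partition_nth N i : (i <= N.+1)%N ->
  nth 1 (0 :: uniform_partition N) i = i%:R / N.+1%:R.
Proof.
case: i => [|i] iN; first by rewrite /= mul0r.
by rewrite /= (nth_map 0%N) ?size_iota// nth_iota// add0n.
Qed.

Lemma uniform_partitionP N : itv_partition 0 1 (uniform_partition N).
Proof.
have sz : size (uniform_partition N) = N.+1 by rewrite size_map size_iota.
split.
  apply/(pathP 1) => i; rewrite sz => iN.
  have -> : nth 1 (uniform_partition N) i = nth 1 (0 :: uniform_partition N) i.+1 by [].
  rewrite !uniform_partition_nth ?(ltnW iN)//.
  by rewrite ltr_pM2r ?invr_gt0 ?ltr0n// ltr_nat.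
have := last_nth 1 0 (uniform_partition N); rewrite sz => ->.
by rewrite uniform_partition_nth// divff// pnatr_eq0.
Qed.

(** A curve of the covering is lifted along a fine partition, each piece being
    as long in the sphere as in the quotient. *)
Lemma exists_lift_end (c : R -> E) x : {within `[0, 1], continuous c} ->
  c 0 = projE x ->
  exists y, projE y = c 1 /\ ((sphere_dist x y)%:E <= curve_length distB (p \o c))%E.
Proof.
move=> /close_lifts_uniform[N closeN] c0.
pose T i : R := i%:R / N.+1%:R.
pose L i := \sum_(0 <= j < i) distB (p (c (T j))) (p (c (T j.+1))).
have N0 : 0 < N.+1%:R :> R by rewrite ltr0n.
have T01 i : (i <= N.+1)%N -> `[0, 1]%classic (T i).
  move=> iN; rewrite /= in_itv/= divr_ge0 ?ler0n//=.
  by rewrite ler_pdivrMr// mul1r ler_nat.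
have lift i : (i <= N.+1)%N -> exists y, projE y = c (T i) /\ sphere_dist x y <= L i.
  elim: i => [_|i IH iN].
    by exists x; rewrite /T mul0r c0 /L big_nil sphere_dist0.
  have [y [yi Ly]] := IH (ltnW iN).
  have [|y' [z' [y'i z'i dyz]]] := closeN _ _ (T01 _ (ltnW iN)) (T01 _ iN).
    rewrite /T -mulrBl -natr1 opprD addrA subrr add0r mulN1r normrN.
    by rewrite ger0_norm// invr_ge0 ltW.
  have /space_form_projP[a ya] : projE y' = projE y by rewrite y'i.
  exists (sub_action to A z' a); split; first by rewrite space_form_proj_act.
  apply: le_trans (sphere_dist_triangle y _ _) _.
  rewrite /L big_nat_recr//=; apply: lerD => //; rewrite -ya.
  by apply: le_trans dyz; rewrite (sub_isometric iso).
have [y [yc Ly]] := lift _ (leqnn N.+1).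
exists y; split; first by rewrite yc /T divff// gt_eqF.
apply: le_trans (ereal_sup_ubound _); last first.
  by exists (uniform_partition N); first exact: uniform_partitionP.
rewrite lee_fin size_map size_iota; apply: le_trans Ly _; rewrite /L big_nat [leRHS]big_nat.
apply: ler_sum => i /andP[_ iN].
have TE j : (j <= N.+1)%N -> T j = nth 1 (0 :: uniform_partition N) j.
  by move=> jN; rewrite uniform_partition_nth.
by rewrite (TE i (ltnW iN)) (TE i.+1 iN).
Qed.

Lemma curve_length_le (c : R -> sphere R n) (l : R) :
  (forall s t, `[0, 1]%classic s -> `[0, 1]%classic t -> s <= t ->
     sphere_dist (c s) (c t) <= l * (t - s)) ->
  (curve_length distB (p \o (projE \o c)) <= l%:E)%E.
Proof.
move=> cl; apply: ge_ereal_sup => _ [s s01 <-]; rewrite lee_fin.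
set F := nth 1 (0 :: s).
apply: (@le_trans _ _ (\sum_(0 <= i < size s) (l * F i.+1 - l * F i))).
  rewrite /= [leLHS]big_nat [leRHS]big_nat; apply: ler_sum => i /andP[_ lti].
  have mem j : (j <= size s)%N -> `[0, 1]%classic (F j).
    move=> js; rewrite /= in_itv/=; apply/andP; split.
      exact: (itv_partition_nth_ge (b := 1) _ s01).
    exact: (itv_partition_nth_le (b := 1) _ s01).
  rewrite /= !cover_projE; apply: le_trans (space_form_dist_le _ _ _) _.
  rewrite -mulrBr; apply: cl; [exact/mem/ltnW|exact: mem|].
  by case: s01 => /(pathP 1)/(_ i lti)/ltW.
rewrite telescope_sumr//.
case: s01 => _ /eqP; rewrite (last_nth 1) -/F => ->.
by rewrite /F /= mulr0 subr0 mulr1.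
Qed.

End Curves.

(** * Great subspheres and their images in the covering *)

Section GreatSubsphere.
Variables (R : realType) (n m : nat) (D : 'M[R]_(n.+1, m)).

(** Subspaces are given as kernels, since the equations [x *m D = 0] are also
    what presents their unit spheres as submanifolds. *)
Definition great_subsphere : set (sphere R n) := [set x | \val x *m D = 0].

Lemma exists_orthogonal_unit (x : sphere R n) : (\rank D < n)%N ->
  exists u, [/\ dot u u = 1, dot (\val x) u = 0 & u *m D = 0].
Proof.
move=> rD; pose K := kermx (row_mx D (\val x)^T).
have : K != 0.
  rewrite kermx_eq0 /row_free neq_ltn; apply/orP; left.
  rewrite -mxrank_tr tr_row_mx trmxK -addsmxE.
  apply: leq_ltn_trans (mxrank_adds_leqif _ _) _; rewrite mxrank_tr.
  apply: (@leq_ltn_trans (\rank D + 1)); first by rewrite leq_add2l rank_leq_row.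
  by rewrite addn1 ltnS.
case/rowV0Pn=> v /sub_kermxP; rewrite mul_mx_row => /eqP.
rewrite row_mx_eq0 => /andP[/eqP vD /eqP vx] /sphere_normalize[k [_ kv]].
exists (k *: v); split=> //; last by rewrite -scalemxAl vD scaler0.
by rewrite dotC dotE -scalemxAl vx scaler0 mxE.
Qed.

(** In dimension at least 2, [x] and [y] span a plane, or lie on a line that is
    contained in one; this plane contains a shortest arc. *)
Lemma exists_arc_direction (x y : sphere R n) : (\rank D < n)%N ->
  great_subsphere x -> great_subsphere y ->
  exists u, [/\ dot u u = 1, dot (\val x) u = 0, u *m D = 0
    & \val y = cos (sphere_dist x y) *: \val x + sin (sphere_dist x y) *: u].
Proof.
move=> rD Dx Dy; set th := sphere_dist x y.
pose w := \val y - cos th *: \val x.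
have cE : cos th = dot (\val x) (\val y) := cos_sphere_dist x y.
have ww : dot w w = sin th ^+ 2.
  rewrite /w !dot_lin !sphere_dot (dotC (\val y)) -cE sin2cos2; ring.
have xw : dot (\val x) w = 0 by rewrite /w !dot_lin sphere_dot -cE; ring.
have [s0|s0] := eqVneq (sin th) 0.
  have [u [u1 xu uD]] := exists_orthogonal_unit x rD.
  exists u; split=> //; rewrite s0 scale0r addr0; apply/eqP.
  by rewrite -subr_eq0; apply/eqP/dot_eq0; rewrite ww s0 expr0n.
exists ((sin th)^-1 *: w); split.
- by rewrite dotZl dotZr ww; field.
- by rewrite dotZr xw mulr0.
- by rewrite -scalemxAl mulmxBl -scalemxAl Dx Dy !(scaler0, subr0).
- by rewrite scalerA divff// scale1r addrC subrK.
Qed.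

Lemma exists_great_arc (x y : sphere R n) : (\rank D < n)%N ->
  great_subsphere x -> great_subsphere y ->
  exists c : R -> sphere R n, [/\ continuous c, c 0 = x, c 1 = y,
    forall t, great_subsphere (c t)
    & forall s t, `[0, 1]%classic s -> `[0, 1]%classic t -> s <= t ->
        sphere_dist (c s) (c t) <= sphere_dist x y * (t - s)].
Proof.
move=> rD Dx Dy; have [u [u1 xu Du yE]] := exists_arc_direction rD Dx Dy.
set th := sphere_dist x y in yE *.
have th0 : 0 <= th := sphere_dist_ge0 x y.
have thpi : th <= pi := sphere_dist_lepi x y.
pose g t : 'rV[R]_n.+1 := cos (t * th) *: \val x + sin (t * th) *: u.
have gg s t : dot (g s) (g t) = cos ((t - s) * th).
  rewrite /g !dot_lin sphere_dot u1 (dotC u) xu mulrBl cosB; ring.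
have g1 t : sphere R n (g t) by rewrite /sphere /= gg subrr mul0r cos0.
exists (fun t => mks (g1 t)); split.
- apply: sphere_continuous => /=.
  have cmul : continuous (fun t : R => t * th) by exact: mulrr_continuous.
  move=> t; apply: cvgD; apply: cvgZr_tmp.
    apply: (@continuous_comp _ _ _ (fun t : R => t * th) cos); first exact: cmul.
    exact: continuous_cos.
  apply: (@continuous_comp _ _ _ (fun t : R => t * th) sin); first exact: cmul.
  exact: continuous_sin.
- by apply/val_inj; rewrite /= /g mul0r cos0 sin0 scale1r scale0r addr0.
- by apply/val_inj; rewrite /= /g mul1r -yE.
- by move=> t; rewrite /great_subsphere /= mulmxDl -!scalemxAl Dx Du !scaler0 addr0.
- move=> s t; rewrite /= !in_itv/= => /andP[s0 s1] /andP[t0 t1] st.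
  rewrite /sphere_dist /= gg cosK 1?mulrC// in_itv/=.
  by apply/andP; split; nra.
Qed.

Lemma great_subsphere_nonempty : (\rank D <= n)%N -> great_subsphere !=set0.
Proof.
move=> rD; have : kermx D != 0 by rewrite kermx_eq0 /row_free neq_ltn ltnS rD.
case/rowV0Pn=> v /sub_kermxP vD /sphere_normalize[k [_ kv]].
by exists (mks kv); rewrite /great_subsphere /= -scalemxAl vD scaler0.
Qed.

Lemma great_subsphere_connected : (\rank D < n)%N -> connected great_subsphere.
Proof.
move=> rD; have [x Dx] := great_subsphere_nonempty (ltnW rD).
have -> : great_subsphere = \bigcup_(C in [set C | [/\ connected C, C x & C `<=` great_subsphere]]) C.
  apply/seteqP; split=> [y Dy|y [C [_ _ CD] Cy]]; last exact: CD.
  have [c [cc c0 c1 Dc _]] := exists_great_arc rD Dx Dy.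
  have c01 : connected (`[0, 1]%classic : set R) by exact: segment_connected.
  exists (c @` `[0, 1]%classic); last by exists 1 => //=; rewrite in_itv/= ler01 lexx.
  split; last by move=> _ [t _ <-].
    by apply: connected_continuous_connected => //; exact: continuous_subspaceT.
  by exists 0 => //=; rewrite in_itv/= ler01 lexx.
by apply: bigcup_connected => [|C []//]; exists x => C [].
Qed.

Lemma great_subsphere_closed : closed great_subsphere.
Proof.
have -> : great_subsphere = (fun x => \val x *m D) @^-1` [set 0] by [].
apply: preimage_closed; last first.
  exact/accessible_closed_set1/hausdorff_accessible/norm_hausdorff.
move=> x _; apply: (@continuous_comp (sphere R n) 'rV[R]_n.+1 'rV[R]_m
  \val (fun y => y *m D)).
  exact: val_continuous.
exact: continuous_mulmxr.
Qed.

Lemma compact_sphere_type : compact [set: sphere R n].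
Proof.
have [x0 s0] := sphere_nonempty R n.
pose f x : sphere R n := insubd (mks s0) x.
have fK (x : sphere R n) : f (\val x) = x by rewrite /f valKd.
have -> : [set: sphere R n] = f @` sphere R n.
  by apply/seteqP; split=> // x _; exists (\val x); rewrite ?fK//; exact: sphere_dot.
apply: continuous_compact; last exact: compact_sphere.
apply/subspace_sigL_continuousP.
have -> : sigL (sphere R n) f = id by apply/funext => x; exact: fK.
by move=> x; exact: cvg_id.
Qed.

Lemma great_subsphere_compact : compact great_subsphere.
Proof.
apply: subclosed_compact great_subsphere_closed compact_sphere_type _.
exact: subsetT.
Qed.

End GreatSubsphere.

(** * Great subspheres are smooth submanifolds *)

Section Quadratic.
Variables (R : realType) (m k : nat).
Implicit Types (L : 'M[R]_(m, k)) (e b : 'rV[R]_k) (y v : 'rV[R]_m).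

Definition quadratic_map L e b y : 'rV[R]_k := y *m L + dot y y *: e + b.

Lemma derivable_coord y v i : derivable (fun z : 'rV[R]_m => z 0 i) y v.
Proof. exact/diff_derivable/differentiable_coord. Qed.

Lemma derive_coord y v i : 'D_v (fun z : 'rV[R]_m => z 0 i) y = v 0 i.
Proof.
have lin : linear (fun z : 'rV[R]_m => z 0 i : R) by move=> a u w; rewrite !mxE.
pose f : {linear 'rV[R]_m -> R} := HB.pack (fun z : 'rV[R]_m => z 0 i : R)
  (GRing.isLinear.Build _ _ _ _ _ lin).
rewrite deriveE; last exact: differentiable_coord.
by rewrite -[fun z => _]/(f : _ -> _) diff_lin//; exact: coord_continuous.
Qed.

Lemma dot_self_sum : (fun y : 'rV[R]_m => dot y y) =
  \sum_(i < m) ((fun z => z 0 i) * (fun z => z 0 i) : 'rV[R]_m -> R).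
Proof. by apply/funext => y; rewrite fct_sumE. Qed.

Lemma differentiable_dot_self y : differentiable (fun y => dot y y) y.
Proof.
rewrite dot_self_sum; apply: differentiable_sum => i.
by apply: differentiableM; exact: differentiable_coord.
Qed.

Lemma derive_dot_self y v : 'D_v (fun y => dot y y) y = 2 * dot y v.
Proof.
rewrite dot_self_sum derive_sum => [|i]; last first.
  by apply: derivableM; exact: derivable_coord.
rewrite /dot mulr_sumr; apply: eq_bigr => i _.
rewrite deriveM ?derive_coord; [|exact: derivable_coord..].
by rewrite /GRing.scale /=; ring.
Qed.

Lemma quadratic_mapE L e b : quadratic_map L e b =
  (mulmxr L + (fun y => dot y y *: e)) + cst b.
Proof. by []. Qed.

Lemma differentiable_mulmxr L y : differentiable (mulmxr L : 'rV[R]_m -> 'rV[R]_k) y.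
Proof. by apply: linear_differentiable; exact: continuous_mulmxr. Qed.

Lemma differentiable_quadratic_map L e b y : differentiable (quadratic_map L e b) y.
Proof.
rewrite quadratic_mapE; apply: differentiableD; last exact: differentiable_cst.
apply: differentiableD; first exact: differentiable_mulmxr.
apply: differentiableZl; exact: differentiable_dot_self.
Qed.

Lemma diff_quadratic_map L e b y v :
  'd (quadratic_map L e b) y v = v *m L + (2 * dot y v) *: e.
Proof.
have dZ : differentiable (fun y => dot y y *: e) y.
  apply: differentiableZl; exact: differentiable_dot_self.
have dL := differentiable_mulmxr L y.
pose q : 'rV[R]_m -> 'rV[R]_k := fun y => dot y y *: e.
pose l : 'rV[R]_m -> 'rV[R]_k := mulmxr L.
have e1 : 'd (l + q) y v = 'd l y v + 'd q y v := congr1 (@^~ v) (diffD dL dZ).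
have e2 : 'd (l + q + cst b) y v = 'd (l + q) y v + 'd (cst b) y v :=
  congr1 (@^~ v) (diffD (differentiableD dL dZ) (differentiable_cst b y)).
have e3 : 'd (cst b) y v = 0 := congr1 (@^~ v) (diff_cst b y).
have e4 : 'd q y v = 'd (fun y => dot y y) y v *: e :=
  congr1 (@^~ v) (diffZl e (differentiable_dot_self y)).
have e5 : 'd l y v = v *m L :=
  congr1 (@^~ v) (diff_lin (f := mulmxr L) y (@continuous_mulmxr R m k L)).
have e6 : 'd (fun y => dot y y) y v = 2 * dot y v.
  by rewrite -(deriveE v (differentiable_dot_self y)) derive_dot_self.
by rewrite -e6 -e4 -e5 -[RHS]addr0 -e3 -e1 -e2.
Qed.

(** A directional derivative of a quadratic map is an affine map, which is again
    of the form [quadratic_map]. *)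
Lemma smooth_quadratic_map L e b U : smooth_on U (quadratic_map L e b).
Proof.
move=> j; elim: j L e b => [|j IH] L e b /=.
  move=> y _; apply: differentiable_continuous.
  exact: differentiable_quadratic_map.
split=> [y _|v]; first exact: differentiable_quadratic_map.
have -> : (fun y => 'D_v (quadratic_map L e b) y) =
    quadratic_map ((2 *: v^T) *m e) 0 (v *m L).
  apply/funext => y; rewrite deriveE; last exact: differentiable_quadratic_map.
  rewrite diff_quadratic_map /quadratic_map scaler0 addr0 addrC; congr (_ + _).
  rewrite -scalemxAl -scalemxAr mulmxA -scalerA; congr (2 *: _).
  by rewrite [y *m v^T]mx11_scalar -dotE mul_scalar_mx.
exact: IH.
Qed.

End Quadratic.

Section GreatSubsphereSubmanifold.
Variables (R : realType) (n m : nat) (D : 'M[R]_(n.+1, m)).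

Local Notation B := (col_base D).

Lemma mulmx_col_base0 (y : 'rV[R]_n.+1) : y *m B = 0 <-> y *m D = 0.
Proof.
split=> [yB|yD]; first by rewrite -(mulmx_base D) mulmxA yB mul0mx.
apply/(row_free_inj (row_base_free D)).
by rewrite mul0mx -mulmxA mulmx_base.
Qed.

(** Near [x], the sphere of [ker D] is the zero set of [y *m B] and
    [dot y y - 1], where [B] consists of independent columns spanning the columns
    of [D]. The differential at [y] of the former takes all values as [B] has
    full rank, and that of the latter is onto already on the line of [x], which
    the former annihilates, as long as [dot y x] is positive. *)
Lemma great_subsphere_submanifold (x : sphere R n) k :
  (k + \rank D = n)%N -> great_subsphere D x ->
  euclidean_submanifold k [set \val w | w in
    [set w : sphere R n | 0 < dot (\val w) (\val x) /\ great_subsphere D w]].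
Proof.
move=> kD Dx z [w [wx Dw] <-].
pose U := [set y : 'rV[R]_n.+1 | 0 < dot y (\val x)].
pose L : 'M[R]_(n.+1, 1 + \rank D) := row_mx 0 B.
pose e : 'rV[R]_(1 + \rank D) := row_mx 1%:M 0.
pose F := quadratic_map L e (- e).
have FE y : F y = row_mx (dot y y - 1)%:M (y *m B).
  rewrite /F /quadratic_map /L /e mul_mx_row scale_row_mx opp_row_mx !add_row_mx.
  rewrite mulmx0 add0r !scaler0 oppr0 !addr0; congr row_mx.
  by rewrite scale_scalar_mx mulr1 -scaleN1r scale_scalar_mx mulr1 -raddfD.
exists (\rank D), U, F; split=> //.
- split=> //; have -> : U = (fun y => dot y (\val x)) @^-1` [set t | 0 < t] by [].
  apply: open_comp; last exact: open_gt.
  move=> y _; apply: (continuous_dot (f := id) (g := cst (\val x))) => t.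
    exact: cvg_id.
  exact: cst_continuous.
- exact: smooth_quadratic_map.
- move=> y Uy; apply/seteqP; split=> // T _.
  have /row_fullP[B' B'B] := col_base_full D.
  pose v0 := rsubmx (T : 'rV[R]_(1 + \rank D)) *m B'.
  pose t0 := (lsubmx (T : 'rV[R]_(1 + \rank D))) 0 0.
  pose s := (t0 / 2 - dot y v0) / dot y (\val x).
  exists (v0 + s *: \val x) => //; rewrite diff_quadratic_map.
  have xB : \val x *m B = 0 by apply/mulmx_col_base0.
  have -> : (v0 + s *: \val x) *m L = row_mx 0 (rsubmx (T : 'rV[R]_(1 + \rank D))).
    by rewrite mul_mx_row mulmx0 mulmxDl -scalemxAl xB scaler0 addr0 -mulmxA B'B mulmx1.
  have sE c : c *: e = row_mx c%:M 0.
    by rewrite /e scale_row_mx scale_scalar_mx mulr1 scaler0.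
  have aE (M : 'M[R]_1) (N : 'M[R]_(1, \rank D)) : row_mx 0 N + row_mx M 0 = row_mx M N.
    by rewrite add_row_mx add0r addr0.
  rewrite sE aE; have -> : (2 * dot y (v0 + s *: \val x))%:M =
      lsubmx (T : 'rV[R]_(1 + \rank D)).
    rewrite [RHS]mx11_scalar -/t0; congr (_%:M).
    by rewrite dotDr dotZr /s; field; rewrite gt_eqF.
  exact: (@hsubmxK _ 1 1 (\rank D) T).
- apply/seteqP; split=> [_ [[v [vx Dv] <-] _]|y [Uy]].
    split=> //; rewrite FE sphere_dot subrr.
    have /mulmx_col_base0 -> := Dv.
    by rewrite raddf0 row_mx0.
  rewrite FE => Fy0.
  have := congr1 (@lsubmx R 1 1 (\rank D)) Fy0; rewrite row_mxKl linear0 => y1.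
  have := congr1 (@rsubmx R 1 1 (\rank D)) Fy0; rewrite row_mxKr linear0.
  move=> /mulmx_col_base0 yD.
  have {}y1 : sphere R n y.
    have := congr1 (fun M : 'M[R]_1 => M 0 0) y1; rewrite !mxE eqxx mulr1n.
    by move=> /eqP; rewrite subr_eq0 => /eqP.
  by split=> //; exists (mks y1).
Qed.

Lemma great_subsphere_line (x y : sphere R n) : \rank D = n ->
  great_subsphere D x -> great_subsphere D y -> 0 < dot (\val y) (\val x) -> y = x.
Proof.
move=> rD /sub_kermxP xD /sub_kermxP yD yx.
have x0 : \val x != 0.
  apply/eqP => x0; have := sphere_dot x; rewrite x0 dot0l.
  by move=> /eqP; rewrite eq_sym oner_eq0.
have /eqmxP : (\val x == kermx D)%MS.
  by rewrite -(mxrank_leqif_eq xD).2 mxrank_ker rD rank_rV x0 subSnn.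
move=> xk; have /sub_rVP[c yc] : (\val y <= \val x)%MS by rewrite xk.
apply/val_inj; have := sphere_dot y; move: yx; rewrite yc !dot_lin !sphere_dot.
move=> c0 c1; have -> : c = 1 by nra.
by rewrite scale1r.
Qed.

End GreatSubsphereSubmanifold.

(** * Totally geodesic submanifolds of the covering *)

Section Submanifolds.
Variables (R : realType) (n : nat) (gT : finGroupType).
Variable to : {action gT &-> sphere R n}.
Variable A : {group gT}.
Hypothesis iso : isometric_action to.
Hypothesis free : free_action to.

Local Notation E := (space_form (sub_action to A)).
Local Notation projE := (space_form_proj (sub_action to A)).
Local Notation distB := (@space_form_dist R n gT to).
Local Notation p := (@cover_proj R n gT to A).

Definition joined_by_lifted_arcs (N : set E) :=
  forall x y : sphere R n, N (projE x) -> N (projE y) ->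
  exists c : R -> sphere R n, [/\ continuous c, c 0 = x, projE (c 1) = projE y,
    forall t, N (projE (c t))
    & forall s t, `[0, 1]%classic s -> `[0, 1]%classic t -> s <= t ->
        sphere_dist (c s) (c t) <= sphere_dist x y * (t - s)].

Lemma covering_dist_le (N : set E) X Y :
  (covering_dist distB p X Y <= length_dist distB p N X Y)%E.
Proof.
by apply: ereal_inf_le_tmp => _ [c [cc _ c0 c1 ->]]; exists c; split.
Qed.

(** A curve of the covering is as long as a curve of the sphere joining two
    lifts of its ends, hence at least as long as an arc joining them. *)
Lemma length_dist_covering_dist (N : set E) X Y : joined_by_lifted_arcs N ->
  N X -> N Y -> length_dist distB p N X Y = covering_dist distB p X Y.
Proof.
move=> arcs NX NY; apply/eqP; rewrite eq_le covering_dist_le andbT.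
apply: le_ereal_inf_tmp => _ [c [cc _ c0 c1 ->]].
have [|y [yc xy]] := exists_lift_end iso free (x := space_form_repr X) cc.
  by rewrite c0 space_form_reprK.
apply: le_trans _ xy.
have [||g [cg g0 g1 Ng gl]] := arcs (space_form_repr X) y.
- by rewrite space_form_reprK.
- by rewrite yc c1.
apply: le_trans _ (curve_length_le to A gl); apply: ereal_inf_lbound.
exists (projE \o g); split=> //.
- apply: continuous_subspaceT => t; apply: continuous_comp; first exact: cg.
  exact: space_form_proj_continuous.
- by move=> t _; exact: Ng.
- by rewrite /= g0 space_form_reprK.
- by rewrite /= g1 yc c1.
Qed.

Lemma length_dist_mem (N : set E) X Y r :
  length_dist distB p N X Y = r%:E -> N X /\ N Y.
Proof.
rewrite /length_dist; set S := (X in ereal_inf X) => Sr.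
have [S0|/set0P[_ [c [_ Nc <- <- _]]]] := eqVneq S set0.
  by move: Sr; rewrite S0 ereal_inf0.
by split; apply: Nc; rewrite /= in_itv/= lexx ler01.
Qed.

Lemma joined_totally_geodesic (N : set E) :
  joined_by_lifted_arcs N -> totally_geodesic distB p N.
Proof.
move=> arcs a b c [v [v0 cv]]; exists v; split=> // t /cv[e [e0 ce]].
exists e; split=> // s s' sab s'ab se s'e.
have css := ce s s' sab s'ab se s'e; have [Ns Ns'] := length_dist_mem css.
by rewrite -(length_dist_covering_dist arcs).
Qed.

Section Invariant.
Variables (m : nat) (D : 'M[R]_(n.+1, m)).
Hypothesis invD : forall a x, a \in A -> great_subsphere D x ->
  great_subsphere D (to x a).

Lemma proj_great_subsphereP x :
  (projE @` great_subsphere D) (projE x) <-> great_subsphere D x.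
Proof.
split=> [[y Dy /sub_proj_eq[a Aa <-]]|Dx]; first exact: invD.
by exists x.
Qed.

(** Near a point [x] of the great subsphere, only the half-sphere around [x] is
    used as chart, so that the two points of a sphere of dimension 0 can be told
    apart. *)
Lemma great_subsphere_smooth_submanifold (N : set E) k : (k + \rank D = n)%N ->
  N `<=` projE @` great_subsphere D ->
  (forall x w : sphere R n, great_subsphere D x -> N (projE x) ->
     0 < dot (\val w) (\val x) -> N (projE w) <-> great_subsphere D w) ->
  smooth_submanifold p k N.
Proof.
move=> kD ND NW X NX; have [x Dx xX] := ND _ NX.
exists [set w | 0 < dot (\val w) (\val x)], projE; split.
- split.
  + have -> : [set w : sphere R n | 0 < dot (\val w) (\val x)] =
      (fun w : sphere R n => dot (\val w) (\val x)) @^-1` [set t | 0 < t] by [].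
    apply: open_comp; last exact: open_gt.
    move=> w _; apply: (continuous_dot (f := \val : sphere R n -> _)
        (g := cst (\val x))) => t; first exact: val_continuous.
    exact: cst_continuous.
  + by apply: continuous_subspaceT; exact: space_form_proj_continuous.
  + by move=> w _; rewrite cover_projE.
- by exists x; rewrite /= sphere_dot ltr01.
- have := great_subsphere_submanifold kD Dx; congr euclidean_submanifold.
  congr image; apply/seteqP; split=> w /= [wx]; rewrite -xX in NX.
    by move/(NW _ _ Dx NX wx).
  by move/(NW _ _ Dx NX wx).
Qed.

(** Two antipodal points are not connected, hence for a line the submanifold is
    one point. *)
Lemma exists_totally_geodesic : (\rank D <= n)%N ->
  exists N : set E, N `<=` projE @` great_subsphere D /\
    compact_totally_geodesic_submanifold p (n - \rank D) N.
Proof.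
rewrite leq_eqVlt => /orP[/eqP rD|rD].
  have [|x Dx] := @great_subsphere_nonempty R n m D; first by rewrite rD.
  exists [set projE x]; split; first by move=> _ ->; exists x.
  split.
  - apply: great_subsphere_smooth_submanifold; first by rewrite rD subnn.
      by move=> _ ->; exists x.
    move=> y w Dy /= xy wy; split=> [/sub_proj_eq wx|Dw].
      have /sub_proj_eq[a Aa <-] : projE x = projE w.
        by case: wx => a Aa aw; apply/esym/sub_proj_eq; exists a.
      exact: invD.
    by rewrite (great_subsphere_line rD Dy Dw wy).
  - by exists (projE x).
  - exact: connected1.
  - exact: compact_set1.
  - apply: joined_totally_geodesic => y z /= yx zx.
    exists (fun=> y); split=> //; first by move=> t; exact: cvg_cst.
      by rewrite yx zx.
    move=> s t _ _ st; rewrite sphere_dist0// mulr_ge0 ?sphere_dist_ge0//.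
    by rewrite subr_ge0.
exists (projE @` great_subsphere D); split=> //; split.
- apply: great_subsphere_smooth_submanifold => //; first by rewrite subnK// ltnW.
  by move=> x w _ _ _; exact: proj_great_subsphereP.
- have [x Dx] := great_subsphere_nonempty (ltnW rD).
  by exists (projE x), x.
- apply: connected_continuous_connected; first exact: great_subsphere_connected.
  by apply: continuous_subspaceT; exact: space_form_proj_continuous.
- apply: continuous_compact; last exact: great_subsphere_compact.
  by apply: continuous_subspaceT; exact: space_form_proj_continuous.
- apply: joined_totally_geodesic => x y /proj_great_subsphereP Dx /proj_great_subsphereP Dy.
  have [c [cc c0 c1 Dc cl]] := exists_great_arc rD Dx Dy.
  exists c; split=> //; first by rewrite c1.
  by move=> t; apply/proj_great_subsphereP.
Qed.

End Invariant.

Lemma set_dist_orthogonal (N1 N2 : set E) (S1 S2 : set (sphere R n)) :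
  (forall a x, a \in A -> S2 x -> S2 (to x a)) ->
  (forall x y, S1 x -> S2 y -> dot (\val x) (\val y) = 0) ->
  N1 `<=` projE @` S1 -> N2 `<=` projE @` S2 ->
  ((pi / 2)%:E <= set_dist distB p N1 N2)%E.
Proof.
move=> inv2 orth NS1 NS2; apply: le_ereal_inf_tmp => _ [[X Y] /= [N1X N2Y] <-].
apply: le_ereal_inf_tmp => _ [c [cc _ c0 c1 ->]].
have [x S1x xX] := NS1 _ N1X; have [y S2y yY] := NS2 _ N2Y.
have [|z [zc xz]] := exists_lift_end iso free (x := x) cc; first by rewrite c0.
apply: le_trans _ xz; rewrite lee_fin.
have /sub_proj_eq[a Aa <-] : projE y = projE z by rewrite zc c1.
by rewrite /sphere_dist orth ?acos0//; exact: inv2.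
Qed.

End Submanifolds.

(** * Orthogonal pairs of invariant subspaces *)

Section Reducibility.
Variables (R : realType) (n : nat) (gT : finGroupType).
Variable to : {action gT &-> sphere R n}.
Hypothesis iso : isometric_action to.

Lemma cyclic_invariant_plane (A : {group gT}) : cyclic A ->
  exists P : 'M[R]_(1 + 1, n.+1), (0 < \rank P <= 2)%N /\
    forall a, a \in A -> stablemx P (rho to a).
Proof.
case/cyclicP=> g ->.
have [P [gP rP]] := orthogonal_invariant_plane (rho_orthogonal iso g).
exists P; split=> // _ /cycleP[k ->].
elim: k => [|k IH]; first by rewrite expg0 rho1// mulmx1.
rewrite expgS rhoM// mulmxA; apply: submx_trans IH.
exact: submxMr.
Qed.

Variables (m : nat) (P : 'M[R]_(m, n.+1)).

Lemma great_subsphere_cokermx_act a x : stablemx P (rho to a) ->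
  great_subsphere (cokermx P) x -> great_subsphere (cokermx P) (to x a).
Proof.
rewrite /great_subsphere /= => Pa /eqP xP; apply/eqP; move: xP.
rewrite -!submxE to_rho// => xP; apply: submx_trans Pa; exact: submxMr.
Qed.

Lemma great_subsphere_tr_act a x : stablemx P (rho to a^-1%g) ->
  great_subsphere P^T x -> great_subsphere P^T (to x a).
Proof.
rewrite /great_subsphere /= to_rho// rhoV// => /submxP[Z PZ] xP.
by rewrite -mulmxA -[rho to a]trmxK -trmx_mul PZ trmx_mul mulmxA xP mul0mx.
Qed.

Lemma great_subsphere_cokermx_tr_orthogonal (x y : sphere R n) :
  great_subsphere (cokermx P) x -> great_subsphere P^T y ->
  dot (\val x) (\val y) = 0.
Proof.
rewrite /great_subsphere /= => /eqP; rewrite -submxE => /submxP[z ->] yP.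
rewrite dotE -mulmxA -[P *m _]trmxK trmx_mul trmxK yP trmx0 mulmx0.
by rewrite mxE.
Qed.

Lemma space_form_connected : (0 < n)%N -> connected [set: space_form to].
Proof.
move=> n0; have -> : [set: space_form to] =
    space_form_proj to @` great_subsphere (0 : 'M[R]_(n.+1, 1)).
  apply/seteqP; split=> // X _; exists (space_form_repr X).
    by rewrite /great_subsphere /= mulmx0.
  exact: space_form_reprK.
apply: connected_continuous_connected.
  by apply: great_subsphere_connected; rewrite mxrank0.
by apply: continuous_subspaceT; exact: space_form_proj_continuous.
Qed.

End Reducibility.

Theorem corollary0p3 (R : realType) (n : nat) (hn : (2 <= n)%N) :
  exists w : R, 0 < w /\
    forall (gT : finGroupType) (to : {action gT &-> sphere R n}),
      isometric_action to -> free_action to ->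
      exists (Mhat : topologicalType) (p : Mhat -> space_form to) (k : nat),
        [/\ normal_covering p, covering_order p k, k%:R <= w
          & exists (M1 M2 : set Mhat) (k1 k2 : nat),
              [/\ compact_totally_geodesic_submanifold p k1 M1,
                  compact_totally_geodesic_submanifold p k2 M2,
                  ((pi / 2)%:E <= set_dist (@space_form_dist R n gT to) p M1 M2)%E
                & (k1 + k2 = n - 1)%N]].
Proof.
exists (index_bound n)%:R; split; first by rewrite ltr0n expn_gt0.
move=> gT to iso free; pose A := near1_group to.
exists (space_form (sub_action to A)), (@cover_proj R n gT to A),
  #|[set: gT]%SET : A|%g; split.
- apply: cover_normal_covering => //; first exact: near1_group_normal.
  exact/space_form_connected/ltnW.
- exact: cover_order.
- by rewrite ler_nat; exact: near1_group_index.
have [P [/andP[r0 r2] invP]] :=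
  cyclic_invariant_plane iso (near1_group_cyclic iso free).
have [||N1 [sub1 geod1]] := @exists_totally_geodesic R n gT to A iso free _ (cokermx P).
- by move=> a x Aa; exact: great_subsphere_cokermx_act (invP a Aa).
- by rewrite mxrank_coker; lia.
have [||N2 [sub2 geod2]] := @exists_totally_geodesic R n gT to A iso free _ P^T.
- move=> a x Aa; apply: great_subsphere_tr_act => //; apply: invP.
  exact: groupVr.
- by rewrite mxrank_tr (leq_trans r2).
exists N1, N2, (n - \rank (cokermx P))%N, (n - \rank P^T)%N; split=> //.
  apply: (set_dist_orthogonal iso free _ _ sub1 sub2).
    move=> a x Aa; apply: great_subsphere_tr_act => //; apply: invP.
    exact: groupVr.
  exact: great_subsphere_cokermx_tr_orthogonal.
have rn : (\rank P <= n)%N := leq_trans r2 hn.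
by rewrite mxrank_coker mxrank_tr; lia.
Qed.
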